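(* Let $E\subset\ell^2(\mathbb{R})$ be a closed subspace of $\ell^2(\mathbb{R})$. Then the following are equivalent: (1) $S_\lambda E=E$ for all $\lambda\in\mathbb{R}$. (2) There exists a measurable set $\sigma\subset\mathbb{R}_B$, unique up to a set of $\mu$-measure $0$, such that $$E=(\mathcal{F}^{-1}\iota^{-1}M_{\mathbf{1}_\sigma}\iota\,\mathcal{F})\,\ell^2(\mathbb{R})=\Big\{f:\mathbb{R}\to\mathbb{C}\ \Big|\ f(\lambda)=\sum_{\alpha\in\mathbb{R}}\widehat{\sigma}(\lambda-\alpha)\,\varphi(\alpha)\ \ (\lambda\in\mathbb{R}),\ \varphi\in\ell^2(\mathbb{R})\Big\}.$$
   Context: $\ell^2(\mathbb{R})$ is the Hilbert space of all functions $f:\mathbb{R}\to\mathbb{C}$ with $\{\lambda\in\mathbb{R}:f(\lambda)\ne0\}$ countable and $\sum_{\lambda\in\mathbb{R}}|f(\lambda)|^2<\infty$, with inner product $\langle f,g\rangle=\sum_{\lambda\in\mathbb{R}}f(\lambda)\overline{g(\lambda)}$. For $\lambda\in\mathbb{R}$, the shift operator $S_\lambda:\ell^2(\mathbb{R})\to\ell^2(\mathbb{R})$ is $(S_\lambda f)(\cdot)=f(\cdot-\lambda)$. $\mathbb{R}_B$ denotes the Bohr compactification of $\mathbb{R}$: the compact abelian group of all (not necessarily continuous) characters $\xi:\mathbb{R}\to\mathbb{T}=\{z\in\mathbb{C}:|z|=1\}$, i.e. the dual group of $\mathbb{R}$ with the discrete topology (here the dual group $\mathbb{R}^*$ is identified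 with $\mathbb{R}$ through the characters $x\mapsto e^{i\theta x}$, $\theta\in\mathbb{R}$). $\mu$ is the normalised Haar measure on $\mathbb{R}_B$, with $\mu(\mathbb{R}_B)=1$. $L^2_\mu(\mathbb{R}_B)$ is the complex Hilbert space of (classes modulo $\mu$-a.e. equality of) square-integrable functions on $\mathbb{R}_B$ with inner product $\langle f,g\rangle=\int_{\mathbb{R}_B}f\,\overline{g}\,d\mu$. For $\lambda\in\mathbb{R}$, $e_\lambda$ is the function $x\mapsto e^{i\lambda x}$ on $\mathbb{R}$. The Besicovitch space $AP^2$ is the completion of the linear span $\mathcal{T}$ of $\{e_\lambda:\lambda\in\mathbb{R}\}$ with respect to the inner product $\langle p,q\rangle=\lim_{R\to\infty}\frac{1}{2R}\int_{-R}^{R}p(x)\overline{q(x)}\,dx$. $\iota:AP^2\to L^2_\mu(\mathbb{R}_B)$ is the canonical Hilbert space isomorphism identifying the two spaces; it is determined by $\iota(e_\lambda)(\xi)=\xi(\lambda)$ for $\xi\in\mathbb{R}_B$, $\lambda\in\mathbb{R}$. The Bohr transform $\mathcal{F}:\ell^2(\mathbb{R})\to AP^2$ is the Hilbert space isomorphism obtained by extending by continuity the map $f\mapsto\sum_{\lambda\in\mathbb{R}}f(\lambda)e_\lambda$ defined on finitely supported $f$. For a measurable set $\sigma\subset\mathbb{R}_B$, $\mathbf{1}_\sigma$ is its characteristic function, $M_{\mathbf{1}_\sigma}:L^2_\mu(\mathbb{R}_B)\to L^2_\mu(\mathbb{R}_B)$ is the multiplication operator $\varphi\mapsto\mathbf{1}_\sigma\varphi$,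 and $\widehat{\sigma}\in\ell^2(\mathbb{R})$ is defined by $$\widehat{\sigma}(\lambda)=\int_{\mathbb{R}_B}\mathbf{1}_\sigma\,\iota(e_{-\lambda})\,d\mu=\int_\sigma\iota(e_{-\lambda})\,d\mu\qquad(\lambda\in\mathbb{R}).$$ Sums over $\alpha\in\mathbb{R}$ of products of two $\ell^2(\mathbb{R})$ functions have at most countably many nonzero terms and converge absolutely by Cauchy–Schwarz. *)

(* Defs.v *)
From HB Require Import structures.
From mathcomp Require Import all_boot all_order all_algebra.
From mathcomp Require Import finmap complex ring lra.
From mathcomp Require Import all_classical all_reals all_analysis measurable_realfun.
From mathcomp.analysis.showcase Require summability.
Set Implicit Arguments. Unset Strict Implicit. Unset Printing Implicit Defensive.
Import Order.TTheory GRing.Theory Num.Theory.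
Import numFieldNormedType.Exports.
Local Open Scope classical_set_scope.
Local Open Scope ring_scope.
Local Open Scope complex_scope.

Lemma add_conjc_le (R : realType) (z : R[i]) : z + conjc z <= `|z| *+ 2.
Proof.
case: z => a b; rewrite normc_def/= -rmorphMn /=.
simpc.
rewrite -mulr2n lerMn2r/=.
rewrite (le_trans (ler_norm _))// -sqrtr_sqr ler_wsqrtr//.
by rewrite lerDl sqr_ge0.
Qed.

(* {dot V for conjc}: linear in the first variable, conjugate-linear in the
   second, Hermitian and positive definite *)
HB.mixin Record isInnerProduct (R : realType) V & NormedModule R[i] V := {
  inner : {dot V for (@conjc R)} ;
  norm_inner : forall x : V, `|x| ^+ 2 = inner x x }.

#[short(type=innerType)]
HB.structure Definition InnerSpace (R : realType) :=
  {V of isInnerProduct R V & NormedModule R[i] V}.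

#[short(type=hilbertType)]
HB.structure Definition Hilbert (R : realType) :=
  {V of InnerSpace R V & CompleteNormedModule R[i] V}.

(* normed module structure with norm sqrt <x, x> *)
HB.factory Record Lmodule_isInner (R : realType) V & GRing.Lmodule R[i] V := {
  dotp : V -> V -> R[i] ;
  dotpDl : forall x y z, dotp (x + y) z = dotp x z + dotp y z ;
  dotpZl : forall a x z, dotp (a *: x) z = a * dotp x z ;
  dotpC : forall x y, dotp x y = conjc (dotp y x) ;
  dotp_gt0 : forall x, x != 0 -> 0 < dotp x x }.

HB.builders Context R V & Lmodule_isInner R V.

Let dotpZr a x z : dotp z (a *: x) = conjc a * dotp z x.
Proof. by rewrite dotpC dotpZl rmorphM/= -dotpC. Qed.

Let dotpDr x y z : dotp z (x + y) = dotp z x + dotp z y.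
Proof. by rewrite dotpC dotpDl rmorphD/= -!dotpC. Qed.

Let dotpNl x z : dotp (- x) z = - dotp x z.
Proof. by rewrite -scaleN1r dotpZl mulN1r. Qed.

Let dotpNr x z : dotp z (- x) = - dotp z x.
Proof. by rewrite dotpC dotpNl rmorphN/= -dotpC. Qed.

Let dotp0 x : dotp 0 x = 0.
Proof. by rewrite -(scale0r 0) dotpZl mul0r. Qed.

Let dotp_ge0 x : 0 <= dotp x x.
Proof.
by have [->|/dotp_gt0/ltW//] := eqVneq x 0; rewrite dotp0.
Qed.

Let dotp_eq0 x : dotp x x = 0 -> x = 0.
Proof.
by move=> h; apply/eqP; apply: contraT => /dotp_gt0; rewrite h ltxx.
Qed.

HB.instance Definition _ := @isBilinear.Build R[i] V V R[i] *%R
  ((@conjc R) \; *%R) dotp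
  (fun z x y => etrans (dotpDl x (- y) z) (congr1 _ (dotpNl y z)))
  (fun z x y => etrans (dotpDr x (- y) z) (congr1 _ (dotpNr y z)))
  (fun z a x => dotpZl a x z)
  (fun z a x => dotpZr a x z).

HB.instance Definition _ :=
  @isHermitianSesquilinear.Build R[i] V false (@conjc R) dotp
    (fun x y => etrans (dotpC x y) (esym (mul1r _))).

HB.instance Definition _ := @isDotProduct.Build R[i] V dotp dotp_gt0.

Let cauchy_schwarz x y : `|dotp x y| ^+ 2 <= dotp x x * dotp y y.
Proof.
have [->|y0] := eqVneq y 0.
  by rewrite dotpC dotp0 conjc0 normr0 expr0n/= mulr_ge0.
have yy := dotp_gt0 y0.
pose a : R[i] := dotp x y / dotp y y.
have yyC : conjc (dotp y y) = dotp y y by rewrite -dotpC.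
have := dotp_ge0 (x - a *: y).
rewrite dotpDl !dotpDr !dotpNl !dotpNr opprK dotpZl !dotpZr dotpZl.
have -> : conjc a = conjc (dotp x y) / dotp y y by rewrite /a rmorphM/= fmorphV/= yyC.
rewrite -[dotp y x](_ : conjc (dotp x y) = _); last by rewrite -dotpC.
rewrite /a sqr_normc.
set u := dotp x y; set v := dotp y y.
rewrite (_ : _ + _ = dotp x x - u * conjc u / v); last first.
  rewrite -/u -/v.
  by field; rewrite gt_eqF.
by rewrite subr_ge0 ler_pdivrMr.
Qed.

Let nrm (x : V) : R[i] := sqrtC (dotp x x).

Let nrmD x y : nrm (x + y) <= nrm x + nrm y.
Proof.
have nn z : 0 <= nrm z by rewrite sqrtC_ge0.
rewrite -(@ler_pXn2r _ 2)// ?nnegrE ?addr_ge0//.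
rewrite sqrrD !sqrtCK dotpDl !dotpDr [dotp y x]dotpC -subr_ge0.
rewrite (_ : _ - _ = nrm x * nrm y *+ 2 - (dotp x y + conjc (dotp x y))); last first.
  by ring.
rewrite subr_ge0 (le_trans (add_conjc_le _))// lerMn2r/=.
rewrite -(@ler_pXn2r _ 2)// ?nnegrE ?mulr_ge0//.
by rewrite exprMn !sqrtCK.
Qed.

Let nrmZ a x : nrm (a *: x) = `|a| * nrm x.
Proof.
rewrite /nrm dotpZl dotpZr mulrA -sqr_normc sqrtCM ?nnegrE ?exprn_ge0//.
by rewrite sqrCK.
Qed.

Let nrm_eq0 x : nrm x = 0 -> x = 0.
Proof. by move/eqP; rewrite sqrtC_eq0 => /eqP/dotp_eq0. Qed.

HB.instance Definition _ := @Lmodule_isNormed.Build R[i] V nrm nrmD nrmZ nrm_eq0.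

HB.instance Definition _ := @isInnerProduct.Build R V dotp (fun x => sqrtCK _).

HB.end.

Section complex_sums.
Import summability.
Context {R : realType} {T : choiceType}.
Implicit Types (g : T -> R) (h : T -> R[i]) (f : T -> R[i]).
Local Instance totally_proper : ProperFilter (@totally T) := totally_filter.

Let abs_summable g := (\esum_(x in [set: T]) `|(g x)%:E| < +oo)%E.

Lemma partial_sumE {V : zmodType} (v : T -> V) (A : {fset T}) :
  partial_sum v A = \sum_(i <- A) v i.
Proof. by rewrite /partial_sum big_seq_fsetE. Qed.

Lemma partial_sum_fsets g (A : {fset T}) :
  (forall x, 0 <= g x) ->
  ((partial_sum g A)%:E <= \esum_(x in [set: T]) (g x)%:E)%E.
Proof.
move=> g0; rewrite partial_sumE -sumEFin.
apply: ereal_sup_ubound; exists [set` A]; first by split.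
by rewrite fsbig_finite//= set_fsetK.
Qed.

Lemma cvg_nneg_sum g : (forall x, 0 <= g x) ->
  (\esum_(x in [set: T]) (g x)%:E < +oo)%E ->
  partial_sum g A @[A --> totally] --> fine (\esum_(x in [set: T]) (g x)%:E).
Proof.
move=> g0 goo.
have gfin : (\esum_(x in [set: T]) (g x)%:E)%E \is a fin_num.
  by rewrite ge0_fin_numE// esum_ge0// => x _; rewrite lee_fin.
apply/cvgrPdist_lt => e e0.
have [_ [B [finB _] <-]] := @ub_ereal_sup_adherent R _ e e0 gfin.
rewrite -/(esum _ _) fsbig_finite//= sumEFin -partial_sumE => Be.
exists (fset_set B) => // A /= BA.
rewrite ger0_norm ?subr_ge0; last first.
  by rewrite -lee_fin fineK// partial_sum_fsets.
rewrite ltrBlDr -ltrBlDl -lte_fin EFinB fineK// (lt_le_trans Be)//.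
rewrite lee_fin !partial_sumE.
rewrite [leRHS](big_fsetID _ (mem (fset_set B)))/=.
rewrite [X in _ <= X + _](_ : _ = \sum_(i <- fset_set B) g i)%R; last first.
  apply: congr_big => //; congr enum_fset; apply/fsetP => x; rewrite !inE/=.
  by apply/andP/idP => [[]//|xB]; split=> //; exact: (fsubsetP BA).
by rewrite lerDl sumr_ge0.
Qed.


Let rsum g : R :=
  fine (\esum_(x in [set: T]) (Num.max (g x) 0)%:E) -
  fine (\esum_(x in [set: T]) (Num.max (- g x) 0)%:E).

Lemma cvg_rsum g : abs_summable g ->
  partial_sum g A @[A --> totally] --> rsum g.
Proof.
move=> gs.
have gpn x : g x = Num.max (g x) 0 - Num.max (- g x) 0.
  have [h|h] := leP 0 (g x); first by rewrite max_r ?subr0// oppr_le0.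
  by rewrite max_l ?oppr_ge0 ?(ltW h)// opprK add0r.
rewrite (_ : (fun A => _) = (fun A =>
    partial_sum (fun x => Num.max (g x) 0) A -
    partial_sum (fun x => Num.max (- g x) 0) A)); last first.
  apply/funext => A; rewrite !partial_sumE -sumrB.
  by apply: eq_bigr => i _; exact: gpn.
apply: cvgB; apply: cvg_nneg_sum; first by move=> x; rewrite le_max lexx orbT.
- apply: le_lt_trans gs; apply: le_esum => x _.
  by rewrite lee_fin ge_max ler_norm normr_ge0.
- by move=> x; rewrite le_max lexx orbT.
- apply: le_lt_trans gs; apply: le_esum => x _.
  by rewrite lee_fin ge_max -normrN ler_norm normr_ge0.
Qed.

Lemma normc_sqr (z : R[i]) :
  Normc.normc z ^+ 2 = complex.Re z ^+ 2 + complex.Im z ^+ 2.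
Proof. by case: z => a b /=; rewrite sqr_sqrtr// addr_ge0 ?sqr_ge0. Qed.

Lemma le_Re_normc (z : R[i]) : `|complex.Re z| <= Normc.normc z.
Proof. by case: z => a b /=; rewrite -sqrtr_sqr ler_wsqrtr// lerDl sqr_ge0. Qed.

Lemma le_Im_normc (z : R[i]) : `|complex.Im z| <= Normc.normc z.
Proof. by case: z => a b /=; rewrite -sqrtr_sqr ler_wsqrtr// lerDr sqr_ge0. Qed.

Lemma normc_mul_le (z w : R[i]) :
  Normc.normc (z * w) <= Normc.normc z ^+ 2 + Normc.normc w ^+ 2.
Proof.
rewrite Normc.normcM; set a := Normc.normc z; set b := Normc.normc w.
have := sqr_ge0 (a - b); have := sqr_ge0 a; have := sqr_ge0 b.
by rewrite sqrrB; lra.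
Qed.

Lemma normc_conjc (z : R[i]) : Normc.normc (conjc z) = Normc.normc z.
Proof. by case: z => a b /=; rewrite sqrrN. Qed.

Lemma normc_lin_le (a z w : R[i]) : Normc.normc (a * z + w) ^+ 2 <=
  2 * (Normc.normc a ^+ 2 * Normc.normc z ^+ 2) + 2 * Normc.normc w ^+ 2.
Proof.
rewrite -exprMn -Normc.normcM !normc_sqr; case: (a * z) => x y; case: w => u v /=.
by have := sqr_ge0 (x - u); have := sqr_ge0 (y - v); rewrite !sqrrB !sqrrD; lra.
Qed.

Lemma cvg_real_complex (I : Type) (F : set_system I) (FF : Filter F)
    (u : I -> R) (l : R) : u i @[i --> F] --> l ->
  (u i)%:C @[i --> F] --> (l%:C : R[i]^o).
Proof.
move=> ul; apply/(@cvgrPdist_lt R[i] R[i]^o) => -[e e'].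
rewrite ltcE/= => /andP[/eqP -> e0].
move/cvgrPdist_lt: ul => /(_ _ e0); apply: filterS => i.
rewrite -rmorphB/= normc_def/= expr0n/= addr0 sqrtr_sqr => h.
by rewrite ltcE/= eqxx.
Qed.

Definition csummable f :=
  (\esum_(x in [set: T]) (Normc.normc (f x))%:E < +oo)%E.

Lemma csummable_Re f : csummable f -> abs_summable (fun x => complex.Re (f x)).
Proof.
apply: le_lt_trans; apply: le_esum => x _.
by rewrite lee_fin le_Re_normc.
Qed.

Lemma csummable_Im f : csummable f -> abs_summable (fun x => complex.Im (f x)).
Proof.
apply: le_lt_trans; apply: le_esum => x _.
by rewrite lee_fin le_Im_normc.
Qed.

Lemma cvg_csum f : csummable f ->
  partial_sum f A @[A --> totally] -->
  (rsum (fun x => complex.Re (f x)) +i* rsum (fun x => complex.Im (f x)) : R[i]^o).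
Proof.
move=> fs.
have decomp (z : R[i]) : z = (complex.Re z)%:C + 'i * (complex.Im z)%:C.
  by case: z => a b; simpc.
rewrite [X in _ --> X]decomp/=.
rewrite (_ : (fun A => _) = (fun A =>
    (partial_sum (fun x => complex.Re (f x)) A)%:C +
    'i * (partial_sum (fun x => complex.Im (f x)) A)%:C)); last first.
  apply/funext => A; rewrite !partial_sumE !rmorph_sum/= mulr_sumr -big_split/=.
  by apply: eq_bigr => i _; exact: decomp.
apply: (@cvgD _ R[i]^o).
  by apply: cvg_real_complex; apply: cvg_rsum; exact: csummable_Re.
apply: (@cvgMr R[i]).
by apply: cvg_real_complex; apply: cvg_rsum; exact: csummable_Im.
Qed.

(* unconditional sum: the limit along the directed set of finite subsets of T *)
Definition csum f : R[i] := sum (f : T -> R[i]^o).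

Lemma csumE f : csummable f ->
  csum f = rsum (fun x => complex.Re (f x)) +i* rsum (fun x => complex.Im (f x)).
Proof. by move=> /cvg_csum/(cvg_lim (@norm_hausdorff _ R[i]^o)). Qed.

Lemma csum_cvg f : csummable f ->
  partial_sum f A @[A --> totally] --> (csum f : R[i]^o).
Proof. by move=> fs; rewrite (csumE fs); exact: cvg_csum. Qed.

Lemma csummableD f h : csummable f -> csummable h ->
  csummable (fun x => f x + h x).
Proof.
move=> fs hs; rewrite /csummable.
apply: (@le_lt_trans _ _ (\esum_(x in [set: T])
  ((Normc.normc (f x))%:E + (Normc.normc (h x))%:E))%E).
  by apply: le_esum => x _; rewrite -EFinD lee_fin le_normcD.
by rewrite esumD ?lte_add_pinfty// => x _; rewrite lee_fin; case: (_ x) => ? ?; exact: sqrtr_ge0.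
Qed.

Lemma csumD f h : csummable f -> csummable h ->
  csum (fun x => f x + h x) = csum f + csum h.
Proof.
move=> fs hs; apply: (cvg_lim (@norm_hausdorff _ R[i]^o)).
rewrite (_ : partial_sum _ = (fun A => partial_sum f A + partial_sum h A)).
  by apply: (@cvgD _ R[i]^o); exact: csum_cvg.
by apply/funext => A; rewrite !partial_sumE big_split.
Qed.

Lemma csumZ a f : csummable f -> csum (fun x => a * f x) = a * csum f.
Proof.
move=> fs; apply: (cvg_lim (@norm_hausdorff _ R[i]^o)).
rewrite (_ : partial_sum _ = (fun A => a * partial_sum f A)).
  by apply: (@cvgMr R[i]); exact: csum_cvg.
by apply/funext => A; rewrite !partial_sumE mulr_sumr.
Qed.

Lemma csummable_conj f : csummable f -> csummable (fun x => conjc (f x)).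
Proof.
rewrite /csummable; congr (_ < _)%E; apply: eq_esum => x _.
by rewrite normc_conjc.
Qed.

Lemma csum_conj f : csummable f ->
  csum (fun x => conjc (f x)) = conjc (csum f).
Proof.
move=> fs; rewrite !csumE//; last exact: csummable_conj.
congr (_ +i* _).
  by congr rsum; apply/funext => x; case: (f x).
rewrite /rsum opprB; congr (_ - _); congr (fine _); apply: eq_esum => x _.
  by case: (f x).
by case: (f x) => a b/=; rewrite opprK.
Qed.

Lemma csum_nneg g : (forall x, 0 <= g x) ->
  (\esum_(x in [set: T]) (g x)%:E < +oo)%E ->
  csum (fun x => (g x)%:C) = (fine (\esum_(x in [set: T]) (g x)%:E))%:C.
Proof.
move=> g0 goo; apply: (cvg_lim (@norm_hausdorff _ R[i]^o)).
rewrite (_ : partial_sum _ = (fun A => (partial_sum g A)%:C)).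
  by apply: cvg_real_complex; exact: cvg_nneg_sum.
by apply/funext => A; rewrite !partial_sumE rmorph_sum.
Qed.

Lemma esumZ_le (k : R) g : 0 <= k ->
  (\esum_(x in [set: T]) (k * g x)%:E <= k%:E * \esum_(x in [set: T]) (g x)%:E)%E.
Proof.
move=> k0; apply: ge_ereal_sup => _ [A [finA _] <-].
rewrite fsbig_finite//= sumEFin -mulr_sumr EFinM lee_wpmul2l ?lee_fin//.
by rewrite -sumEFin -fsbig_finite//; apply: ereal_sup_ubound; exists A.
Qed.

End complex_sums.


Section ell2.
Context {R : realType}.
Implicit Types f g : R -> R[i].

Definition sqsum f : \bar R :=
  (\esum_(x in [set: R]) (Normc.normc (f x) ^+ 2)%:E)%E.

Definition l2_pred : {pred R -> R[i]} :=
  mem [set f | countable [set x | f x != 0] /\ (sqsum f < +oo)%E].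

Lemma l2P f : reflect (countable [set x | f x != 0] /\ (sqsum f < +oo)%E)
  (f \in l2_pred).
Proof. by apply: (iffP idP) => [/set_mem|/mem_set]. Qed.

Lemma l2_submod_closed : submod_closed l2_pred.
Proof.
split.
  apply/l2P; split.
    by rewrite (_ : mkset _ = set0)// -subset0 => x /=; rewrite eqxx.
  by rewrite /sqsum esum1// => x _; rewrite Normc.normc0 expr0n.
move=> a f g /l2P[fc fs] /l2P[gc gs]; apply/l2P; split.
  pose F := fun b : bool => if b then [set x | f x != 0] else [set x | g x != 0].
  apply: (@sub_countable _ _ _ (\bigcup_(b in [set: bool]) F b)).
    apply: subset_card_le => x /= h.
    have [f0|f0] := eqVneq (f x) 0; last by exists true.
    exists false => //=; apply: contra h => /eqP g0.
    by apply/eqP; rewrite -[LHS]/(a * f x + g x) f0 g0 mulr0 addr0.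
  by apply: bigcup_countable => // -[].
pose A : R := 2 * Normc.normc a ^+ 2.
have A0 : 0 <= A by rewrite mulr_ge0// sqr_ge0.
apply: (@le_lt_trans _ _ (\esum_(x in [set: R])
  ((A * Normc.normc (f x) ^+ 2)%:E + (2 * Normc.normc (g x) ^+ 2)%:E))%E).
  apply: le_esum => x _; rewrite -EFinD lee_fin /A -mulrA.
  exact: normc_lin_le.
rewrite esumD; last 2 first.
  by move=> x _; rewrite lee_fin mulr_ge0// sqr_ge0.
  by move=> x _; rewrite lee_fin mulr_ge0// sqr_ge0.
have sq0 (h : R -> R[i]) : (0 <= sqsum h)%E.
  by apply: esum_ge0 => x _; rewrite lee_fin sqr_ge0.
rewrite lte_add_pinfty//; apply: le_lt_trans (esumZ_le _ _) _ => //.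
  by rewrite lte_mul_pinfty// ?fin_numE// lee_fin.
by rewrite lte_mul_pinfty// lee_fin.
Qed.

HB.instance Definition _ := GRing.isSubmodClosed.Build _ _ l2_pred
  l2_submod_closed.

Lemma l2_csummable f g : f \in l2_pred -> g \in l2_pred ->
  csummable (fun x => f x * conjc (g x)).
Proof.
move=> /l2P[_ fs] /l2P[_ gs].
apply: (@le_lt_trans _ _ (\esum_(x in [set: R])
  ((Normc.normc (f x) ^+ 2)%:E + (Normc.normc (g x) ^+ 2)%:E))%E).
  apply: le_esum => x _; rewrite -EFinD lee_fin -[in leRHS](normc_conjc (g x)).
  exact: normc_mul_le.
rewrite esumD; first by rewrite lte_add_pinfty.
- by move=> x _; rewrite lee_fin sqr_ge0.
- by move=> x _; rewrite lee_fin sqr_ge0.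
Qed.

End ell2.

Record l2 (R : realType) := L2Fun { l2_val :> R -> R[i] ; _ : l2_val \in l2_pred }.

Section ell2_type.
Context {R : realType}.
Implicit Types f g : l2 R.

HB.instance Definition _ := [isSub of l2 R for @l2_val R].
HB.instance Definition _ := [Choice of l2 R by <:].
HB.instance Definition _ := [SubChoice_isSubLmodule of l2 R by <:].

Lemma l2_valP f : (f : R -> R[i]) \in l2_pred. Proof. exact: valP. Qed.

Definition l2_form f g : R[i] := csum (fun x => f x * conjc (g x)).

Lemma l2_formDl f g h : l2_form (f + g) h = l2_form f h + l2_form g h.
Proof.
rewrite /l2_form -csumD; try by apply: l2_csummable; exact: l2_valP.
by congr csum; apply/funext => x; rewrite -mulrDl.
Qed.

Lemma l2_formZl a f g : l2_form (a *: f) g = a * l2_form f g.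
Proof.
rewrite /l2_form -csumZ; last by apply: l2_csummable; exact: l2_valP.
by congr csum; apply/funext => x; rewrite mulrA.
Qed.

Lemma l2_formC f g : l2_form f g = conjc (l2_form g f).
Proof.
rewrite /l2_form -csum_conj; last by apply: l2_csummable; exact: l2_valP.
by congr csum; apply/funext => x; rewrite rmorphM/= conjcK mulrC.
Qed.

Lemma l2_form_gt0 f : f != 0 -> 0 < l2_form f f.
Proof.
move=> f0; have /l2P[_ fs] := l2_valP f.
have -> : l2_form f f = (fine (sqsum f))%:C.
  rewrite -csum_nneg//; last by move=> x; exact: sqr_ge0.
  congr csum; apply/funext => x.
  by rewrite -sqr_normc normc_def -rmorphXn/= normc_sqr sqr_sqrtr// addr_ge0 ?sqr_ge0.
have [x fx] : exists x, f x != 0.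
  apply: contrapT => /forallNP h; move/eqP: f0; apply; apply/val_inj/funext => x.
  by have /negP/negPn/eqP := h x.
rewrite ltcE/= eqxx/= fine_gt0// fs andbT.
apply: (@lt_le_trans _ _ (Normc.normc (f x) ^+ 2)%:E).
  rewrite lte_fin exprn_gt0// lt_neqAle eq_sym; apply/andP; split.
    by apply: contra fx => /eqP/Normc.eq0_normc ->.
  by case: (f x) => ? ?; exact: sqrtr_ge0.
apply: esum_ge; exists [set x]; first by split.
by rewrite fsbig_set1.
Qed.

HB.instance Definition _ := Lmodule_isInner.Build R (l2 R)
  l2_formDl l2_formZl l2_formC l2_form_gt0.

Lemma l2_innerE f g : inner f g = csum (fun x => f x * conjc (g x)).
Proof. by []. Qed.

Lemma l2_shift_subproof (lam : R) f : (fun x => f (x - lam)) \in l2_pred.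
Proof.
have /l2P[fc fs] := l2_valP f; apply/l2P; split.
  rewrite (_ : mkset _ = (fun y => y + lam) @` [set x | f x != 0]).
    exact: sub_countable (card_image_le _ _) fc.
  apply/seteqP; split => [x /= fx|_ [y /= fy <-]]; last by rewrite addrK.
  by exists (x - lam) => //; rewrite subrK.
rewrite /sqsum -(@reindex_esum R R R setT setT (fun x => x - lam)
  (fun x => (Normc.normc (f x) ^+ 2)%:E))//.
split=> //; first by move=> x y _ _ /addIr.
by move=> x _; exists (x + lam) => //; rewrite addrK.
Qed.

Definition l2_shift (lam : R) f : l2 R := L2Fun (l2_shift_subproof lam f).

End ell2_type.

Section complex_integral.
Context d {T : measurableType d} {R : realType} (mu : {measure set T -> \bar R}).
Implicit Types (D : set T) (f g h : T -> R[i]).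

Definition cintegral D f : R[i] :=
  (\int[mu]_(x in D) complex.Re (f x)) +i* (\int[mu]_(x in D) complex.Im (f x)).

Definition cmeasurable f :=
  measurable_fun [set: T] (fun x => complex.Re (f x)) /\
  measurable_fun [set: T] (fun x => complex.Im (f x)).

Definition cintegrable f := cmeasurable f /\
  (\int[mu]_x (Normc.normc (f x))%:E < +oo)%E.

Lemma measurable_normc_sqr f : cmeasurable f ->
  measurable_fun [set: T] (fun x => Normc.normc (f x) ^+ 2).
Proof.
move=> [mr mi]; apply: eq_measurable_fun (_ : measurable_fun _ (fun x =>
  complex.Re (f x) ^+ 2 + complex.Im (f x) ^+ 2)).
  by move=> x _; rewrite normc_sqr.
by apply: measurable_funD; exact: measurable_funX.
Qed.

Lemma measurable_normc f : cmeasurable f ->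
  measurable_fun [set: T] (fun x => Normc.normc (f x)).
Proof.
move=> mf; apply: eq_measurable_fun (_ : measurable_fun _ (fun x =>
  (Normc.normc (f x) ^+ 2) `^ 2^-1)).
  move=> x _; rewrite powR12_sqrt ?sqr_ge0// sqrtr_sqr ger0_norm//.
  by case: (f x) => ? ?; exact: sqrtr_ge0.
apply: (@measurableT_comp _ _ _ _ _ _ (fun x : R => x `^ 2^-1)) => //.
exact: measurable_normc_sqr.
Qed.

Lemma cintegrable_Re f : cintegrable f ->
  mu.-integrable [set: T] (EFin \o (fun x => complex.Re (f x))).
Proof.
move=> [mf fi]; have [mr _] := mf; apply/integrableP; split.
  exact/measurable_EFinP.
apply: le_lt_trans fi; apply: ge0_le_integral => //.
- by apply/measurable_EFinP; exact: measurableT_comp.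
- by apply/measurable_EFinP; exact: measurable_normc.
- by move=> x _; rewrite lee_fin le_Re_normc.
Qed.

Lemma cintegrable_Im f : cintegrable f ->
  mu.-integrable [set: T] (EFin \o (fun x => complex.Im (f x))).
Proof.
move=> [mf fi]; have [_ mi] := mf; apply/integrableP; split.
  exact/measurable_EFinP.
apply: le_lt_trans fi; apply: ge0_le_integral => //.
- by apply/measurable_EFinP; exact: measurableT_comp.
- by apply/measurable_EFinP; exact: measurable_normc.
- by move=> x _; rewrite lee_fin le_Im_normc.
Qed.

Lemma cintegralD f g : cintegrable f -> cintegrable g ->
  cintegral [set: T] (fun x => f x + g x) =
  cintegral [set: T] f + cintegral [set: T] g.
Proof.
move=> fi gi; rewrite /cintegral; simpc; congr (_ +i* _).
- rewrite -RintegralD//; try exact: cintegrable_Re.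
  by apply: eq_Rintegral => x _; case: (f x) => ? ?; case: (g x).
- rewrite -RintegralD//; try exact: cintegrable_Im.
  by apply: eq_Rintegral => x _; case: (f x) => ? ?; case: (g x).
Qed.

Lemma cintegralZ a f : cintegrable f ->
  cintegral [set: T] (fun x => a * f x) = a * cintegral [set: T] f.
Proof.
move=> fi; have rf := cintegrable_Re fi; have If := cintegrable_Im fi.
case: a => a b; rewrite /cintegral; simpc; congr (_ +i* _).
- rewrite -!RintegralZl// -RintegralB//; last 2 first.
  + exact: (integrableZl measurableT a rf).
  + exact: (integrableZl measurableT b If).
  by apply: eq_Rintegral => x _; case: (f x) => ? ?; simpc.
- rewrite -!RintegralZl// -RintegralD//; last 2 first.
  + exact: (integrableZl measurableT a If).
  + exact: (integrableZl measurableT b rf).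
  by apply: eq_Rintegral => x _; case: (f x) => ? ?; simpc.
Qed.

Lemma cintegral_conj f : cintegrable f ->
  cintegral [set: T] (fun x => conjc (f x)) = conjc (cintegral [set: T] f).
Proof.
move=> fi; rewrite /cintegral/=; congr (_ +i* _).
  by apply: eq_Rintegral => x _; case: (f x).
rewrite -mulN1r -RintegralZl//; last exact: cintegrable_Im.
by apply: eq_Rintegral => x _; case: (f x) => ? ?; rewrite mulN1r.
Qed.

Lemma ae_eq_cintegral f g : cmeasurable f -> cmeasurable g ->
  (\forall x \ae mu, f x = g x) ->
  cintegral [set: T] f = cintegral [set: T] g.
Proof.
move=> [mr mi] [mr' mi'] fg; congr (_ +i* _); congr fine.
  apply: ae_eq_integral => //; try exact/measurable_EFinP.
  by apply: filterS fg => x -> _.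
apply: ae_eq_integral => //; try exact/measurable_EFinP.
by apply: filterS fg => x -> _.
Qed.

Lemma cmeasurableD f g : cmeasurable f -> cmeasurable g ->
  cmeasurable (fun x => f x + g x).
Proof.
move=> [mr mi] [mr' mi']; split.
- apply: eq_measurable_fun (measurable_funD mr mr') => x _ /=.
  by case: (f x) => ? ?; case: (g x).
- apply: eq_measurable_fun (measurable_funD mi mi') => x _ /=.
  by case: (f x) => ? ?; case: (g x).
Qed.

Lemma cmeasurableM f g : cmeasurable f -> cmeasurable g ->
  cmeasurable (fun x => f x * g x).
Proof.
move=> [mr mi] [mr' mi']; split.
- apply: eq_measurable_fun
    (measurable_funB (measurable_funM mr mr') (measurable_funM mi mi')) => x _ /=.
  by case: (f x) => ? ?; case: (g x) => ? ?; simpc.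
- apply: eq_measurable_fun
    (measurable_funD (measurable_funM mr mi') (measurable_funM mi mr')) => x _ /=.
  by case: (f x) => ? ?; case: (g x) => ? ?; simpc.
Qed.

Lemma cmeasurable_cst a : cmeasurable (fun=> a).
Proof. by split; exact: measurable_cst. Qed.

Lemma cmeasurable_conj f : cmeasurable f -> cmeasurable (fun x => conjc (f x)).
Proof.
move=> [mr mi]; split.
- by apply: eq_measurable_fun mr => x _; case: (f x).
- by apply: eq_measurable_fun (measurable_funN mi) => x _ /=; case: (f x).
Qed.

Definition sqint_pred : {pred T -> R[i]} := mem [set f |
  cmeasurable f /\ (\int[mu]_x (Normc.normc (f x) ^+ 2)%:E < +oo)%E].

Lemma sqintP f : reflect
  (cmeasurable f /\ (\int[mu]_x (Normc.normc (f x) ^+ 2)%:E < +oo)%E)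
  (f \in sqint_pred).
Proof. by apply: (iffP idP) => [/set_mem|/mem_set]. Qed.

Lemma sqint_submod_closed : submod_closed sqint_pred.
Proof.
split.
  apply/sqintP; split; first exact: cmeasurable_cst.
  by under eq_integral do rewrite Normc.normc0 expr0n/=; rewrite integral0.
move=> a f g /sqintP[mf fi] /sqintP[mg gi].
have mfg : cmeasurable (a *: f + g).
  by apply: cmeasurableD => //; apply: cmeasurableM => //; exact: cmeasurable_cst.
apply/sqintP; split => //.
pose A : R := 2 * Normc.normc a ^+ 2.
have A0 : 0 <= A by rewrite mulr_ge0// sqr_ge0.
have mf2 := measurable_normc_sqr mf.
have mg2 := measurable_normc_sqr mg.
apply: (@le_lt_trans _ _ (\int[mu]_x
  (A%:E * (Normc.normc (f x) ^+ 2)%:E + 2%:E * (Normc.normc (g x) ^+ 2)%:E))%E).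
  apply: ge0_le_integral => //.
  - by move=> x _; rewrite lee_fin sqr_ge0.
  - by apply/measurable_EFinP; exact: measurable_normc_sqr.
  - apply: emeasurable_funD.
      by apply: measurable_funeM; exact/measurable_EFinP.
    by apply: measurable_funeM; exact/measurable_EFinP.
  - move=> x _; rewrite -!EFinM -EFinD lee_fin /A -mulrA.
    exact: normc_lin_le.
rewrite ge0_integralD//; last 4 first.
- by move=> x _; rewrite mule_ge0// lee_fin// sqr_ge0.
- by apply: measurable_funeM; exact/measurable_EFinP.
- by move=> x _; rewrite mule_ge0// lee_fin// sqr_ge0.
- by apply: measurable_funeM; exact/measurable_EFinP.
rewrite !ge0_integralZl//; try exact/measurable_EFinP;
  try by move=> x _; rewrite lee_fin sqr_ge0.
by rewrite lte_add_pinfty// lte_mul_pinfty// lee_fin.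
Qed.

HB.instance Definition _ := GRing.isSubmodClosed.Build _ _ sqint_pred
  sqint_submod_closed.

Lemma sqint_cintegrable f g : f \in sqint_pred -> g \in sqint_pred ->
  cintegrable (fun x => f x * conjc (g x)).
Proof.
move=> /sqintP[mf fi] /sqintP[mg gi].
have mfg := cmeasurableM mf (cmeasurable_conj mg).
split=> //.
apply: (@le_lt_trans _ _ (\int[mu]_x
  ((Normc.normc (f x) ^+ 2)%:E + (Normc.normc (g x) ^+ 2)%:E))%E).
  apply: ge0_le_integral => //.
  - move=> x _; rewrite lee_fin.
    by case: (_ * _) => ? ?; exact: sqrtr_ge0.
  - by apply/measurable_EFinP; exact: measurable_normc.
  - by apply: emeasurable_funD; apply/measurable_EFinP; exact: measurable_normc_sqr.
  - move=> x _; rewrite -EFinD lee_fin -[in leRHS](normc_conjc (g x)).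
    exact: normc_mul_le.
rewrite ge0_integralD//; first by rewrite lte_add_pinfty.
- by move=> x _; rewrite lee_fin sqr_ge0.
- by apply/measurable_EFinP; exact: measurable_normc_sqr.
- by move=> x _; rewrite lee_fin sqr_ge0.
- by apply/measurable_EFinP; exact: measurable_normc_sqr.
Qed.

End complex_integral.

Record sqint d {T : measurableType d} {R : realType}
    (mu : {measure set T -> \bar R}) :=
  Sqint { sqint_val :> T -> R[i] ; _ : sqint_val \in sqint_pred mu }.

Section sqint_type.
Context d {T : measurableType d} {R : realType} (mu : {measure set T -> \bar R}).

HB.instance Definition _ := [isSub of sqint mu for @sqint_val d T R mu].
HB.instance Definition _ := [Choice of sqint mu by <:].
HB.instance Definition _ := [SubChoice_isSubLmodule of sqint mu by <:].

Implicit Types f g : sqint mu.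

Lemma sqint_valP f : (f : T -> R[i]) \in sqint_pred mu. Proof. exact: valP. Qed.

Lemma sqint_cmeasurable f : cmeasurable f.
Proof. by case/sqintP: (sqint_valP f). Qed.

Definition ae0 : {pred sqint mu} := mem [set f : sqint mu | \forall x \ae mu, f x = 0].

Lemma ae0P f : reflect (\forall x \ae mu, f x = 0) (f \in ae0).
Proof. by apply: (iffP idP) => [/set_mem|/mem_set]. Qed.

Lemma ae0_submod_closed : submod_closed ae0.
Proof.
split; first by apply/ae0P; exact: aeW.
move=> a f g /ae0P f0 /ae0P g0; apply/ae0P; apply: filterS2 f0 g0 => x fx gx.
by rewrite -[LHS]/(a * f x + g x) fx gx mulr0 addr0.
Qed.

HB.instance Definition _ := GRing.isSubmodClosed.Build _ _ ae0
  ae0_submod_closed.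

End sqint_type.

(* square-integrable functions modulo a.e. equality (see L2_classE) *)
Definition L2 d {T : measurableType d} {R : realType}
  (mu : {measure set T -> \bar R}) : Type := Quotient.quot (@ae0 d T R mu).

Section L2_type.
Context d {T : measurableType d} {R : realType} (mu : {measure set T -> \bar R}).
Local Open Scope quotient_scope.

HB.instance Definition _ := GRing.Zmodule.on (L2 mu).
HB.instance Definition _ := EqQuotient.on (L2 mu).
HB.instance Definition _ := ZmodQuotient.on (L2 mu).

Implicit Types (u v w : L2 mu) (f g : sqint mu).

Definition L2_class f : L2 mu := \pi f.
Definition L2_repr u : sqint mu := repr u.

Lemma L2_classE f g : L2_class f = L2_class g <-> \forall x \ae mu, f x = g x.
Proof.
rewrite /L2_class; split => [/eqP|fg].
  rewrite -Quotient.idealrBE => /ae0P; apply: filterS => x.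
  by rewrite -[LHS]/(f x - g x) => /eqP; rewrite subr_eq0 => /eqP.
apply/eqP; rewrite -Quotient.idealrBE; apply/ae0P; apply: filterS fg => x fg.
by rewrite -[LHS]/(f x - g x) fg subrr.
Qed.

Lemma L2_reprK u : L2_class (L2_repr u) = u.
Proof. exact: reprK. Qed.

Lemma L2_classK f : \forall x \ae mu, L2_repr (L2_class f) x = f x.
Proof. by apply/L2_classE; rewrite L2_reprK. Qed.

Lemma L2_classD f g : L2_class (f + g) = L2_class f + L2_class g.
Proof. by rewrite /L2_class !piE. Qed.

Definition L2_scale (a : R[i]) u : L2 mu := L2_class (a *: L2_repr u).

Lemma L2_classZ a f : L2_class (a *: f) = L2_scale a (L2_class f).
Proof.
apply/L2_classE; apply: filterS (L2_classK f) => x h.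
by rewrite -[LHS]/(a * f x) -[RHS]/(a * L2_repr (L2_class f) x) h.
Qed.

Lemma L2_scalerA a b u : L2_scale a (L2_scale b u) = L2_scale (a * b) u.
Proof. by rewrite -(L2_reprK u) -!L2_classZ scalerA. Qed.
Lemma L2_scale1r u : L2_scale 1 u = u.
Proof. by rewrite /L2_scale scale1r L2_reprK. Qed.
Lemma L2_scalerDr a u v : L2_scale a (u + v) = L2_scale a u + L2_scale a v.
Proof.
by rewrite -(L2_reprK u) -(L2_reprK v) -L2_classD -!L2_classZ scalerDr L2_classD.
Qed.
Lemma L2_scalerDl u a b : L2_scale (a + b) u = L2_scale a u + L2_scale b u.
Proof. by rewrite -(L2_reprK u) -!L2_classZ scalerDl L2_classD. Qed.

HB.instance Definition _ := GRing.Zmodule_isLmodule.Build R[i] (L2 mu)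
  L2_scalerA L2_scale1r L2_scalerDr L2_scalerDl.

Definition L2_form u v : R[i] :=
  cintegral mu [set: T] (fun x => L2_repr u x * conjc (L2_repr v x)).

Lemma L2_form_class f g : L2_form (L2_class f) (L2_class g) =
  cintegral mu [set: T] (fun x => f x * conjc (g x)).
Proof.
apply: ae_eq_cintegral.
- by apply: cmeasurableM; [|apply: cmeasurable_conj]; exact: sqint_cmeasurable.
- by apply: cmeasurableM; [|apply: cmeasurable_conj]; exact: sqint_cmeasurable.
- by apply: filterS2 (L2_classK f) (L2_classK g) => x -> ->.
Qed.

Lemma sqint_mul_cintegrable f g : cintegrable mu (fun x => f x * conjc (g x)).
Proof. by apply: sqint_cintegrable; exact: sqint_valP. Qed.

Lemma L2_formDl u v w : L2_form (u + v) w = L2_form u w + L2_form v w.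
Proof.
rewrite -(L2_reprK u) -(L2_reprK v) -(L2_reprK w) -L2_classD !L2_form_class.
rewrite -cintegralD; try exact: sqint_mul_cintegrable.
by congr cintegral; apply/funext => x; rewrite -mulrDl.
Qed.

Lemma L2_formZl a u v : L2_form (a *: u) v = a * L2_form u v.
Proof.
rewrite -(L2_reprK u) -(L2_reprK v) -[_ *: _]L2_classZ !L2_form_class.
rewrite -cintegralZ; last exact: sqint_mul_cintegrable.
by congr cintegral; apply/funext => x; rewrite mulrA.
Qed.

Lemma L2_formC u v : L2_form u v = conjc (L2_form v u).
Proof.
rewrite /L2_form -cintegral_conj; last exact: sqint_mul_cintegrable.
by congr cintegral; apply/funext => x; rewrite rmorphM/= conjcK mulrC.
Qed.

Lemma L2_form_gt0 u : u != 0 -> 0 < L2_form u u.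
Proof.
move=> u0.
have E x : L2_repr u x * conjc (L2_repr u x) =
    (Normc.normc (L2_repr u x) ^+ 2)%:C.
  by rewrite -sqr_normc normc_def -rmorphXn/= normc_sqr sqr_sqrtr// addr_ge0 ?sqr_ge0.
have [mf fi] := sqintP _ _ (sqint_valP (L2_repr u)).
have -> : L2_form u u =
    (fine (\int[mu]_x (Normc.normc (L2_repr u x) ^+ 2)%:E))%:C.
  congr (_ +i* _); first by apply: eq_Rintegral => x _; rewrite E.
  rewrite (@eq_Rintegral _ _ _ _ _ (cst 0)); last by move=> x _; rewrite E.
  by rewrite Rintegral_cst// mul0r.
rewrite ltcE/= eqxx/= fine_gt0// fi andbT lt_neqAle integral_ge0; last first.
  by move=> x _; rewrite lee_fin sqr_ge0.
rewrite andbT; apply: contra u0 => /eqP/esym h.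
rewrite -(L2_reprK u); apply/eqP.
rewrite (_ : 0 = L2_class 0); last by rewrite /L2_class !piE.
apply/L2_classE.
have : (\int[mu]_x `|(Normc.normc (L2_repr u x) ^+ 2)%:E|)%E = 0%E.
  by rewrite -[RHS]h; apply: eq_integral => x _; rewrite gee0_abs// lee_fin sqr_ge0.
move/ae_eq_integral_abs => /(_ measurableT).
move=> /(_ ((measurable_EFinP _ _).2 (measurable_normc_sqr mf))).
apply: filterS => x /(_ I) [] /eqP; rewrite sqrf_eq0 => /eqP.
exact: Normc.eq0_normc.
Qed.

HB.instance Definition _ := Lmodule_isInner.Build R (L2 mu)
  L2_formDl L2_formZl L2_formC L2_form_gt0.

Lemma L2_innerE u v : inner u v =
  cintegral mu [set: T] (fun x => L2_repr u x * conjc (L2_repr v x)).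
Proof. by []. Qed.


End L2_type.

Section mul_indic.
Context d {T : measurableType d} {R : realType} (mu : {measure set T -> \bar R}).

Lemma sqint_mul_indic_subproof (S : set T) (f : sqint mu) : measurable S ->
  (fun x => (\1_S x)%:C * f x) \in sqint_pred mu.
Proof.
move=> mS; have [mf fi] := sqintP _ _ (sqint_valP f).
have mS' : cmeasurable (fun x => (\1_S x : R)%:C).
  by split; [exact: measurable_indic|exact: measurable_cst].
have mSf := cmeasurableM mS' mf.
apply/sqintP; split => //.
apply: le_lt_trans fi; apply: ge0_le_integral => //.
- by move=> x _; rewrite lee_fin sqr_ge0.
- by apply/measurable_EFinP; exact: measurable_normc_sqr.
- by apply/measurable_EFinP; exact: measurable_normc_sqr.
- move=> x _; rewrite lee_fin indicE; case: (_ \in _).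
    by rewrite rmorph1 mul1r.
  by rewrite rmorph0 mul0r Normc.normc0 expr0n sqr_ge0.
Qed.

Definition L2_mul_indic (S : set T) (mS : measurable S) (u : L2 mu) : L2 mu :=
  L2_class (Sqint (sqint_mul_indic_subproof (L2_repr u) mS)).

End mul_indic.

Record hilbert_iso (R : realType) (U V : innerType R) := HilbertIso {
  iso_fun :> {linear U -> V} ;
  iso_inv : V -> U ;
  iso_funK : cancel iso_fun iso_inv ;
  iso_invK : cancel iso_inv iso_fun ;
  iso_inner : forall x y, inner (iso_fun x) (iso_fun y) = inner x y }.

Definition bohr_pred (R : realType) : {pred R -> R[i]} := mem [set xi |
  (forall x, `|xi x| = 1) /\ (forall x y, xi (x + y) = xi x * xi y)].

Record bohr (R : realType) :=
  Bohr { bohr_val :> R -> R[i] ; _ : bohr_val \in @bohr_pred R }.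

Section bohr_type.
Context {R : realType}.

HB.instance Definition _ := [isSub of bohr R for @bohr_val R].
HB.instance Definition _ := [Choice of bohr R by <:].

Lemma bohrP (xi : R -> R[i]) : reflect
  ((forall x, `|xi x| = 1) /\ (forall x y, xi (x + y) = xi x * xi y))
  (xi \in @bohr_pred R).
Proof. by apply: (iffP idP) => [/set_mem|/mem_set]. Qed.

Lemma bohr1_subproof : (fun=> 1) \in @bohr_pred R.
Proof. by apply/bohrP; split=> [x|x y]; rewrite ?normr1 ?mulr1. Qed.

Definition bohr1 : bohr R := Bohr bohr1_subproof.

Lemma bohr_mul_subproof (xi eta : bohr R) :
  (fun x => xi x * eta x) \in @bohr_pred R.
Proof.
have [/bohrP[x1 xM] /bohrP[e1 eM]] := (valP xi, valP eta).
apply/bohrP; split=> [x|x y]; first by rewrite normrM x1 e1 mulr1.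
by rewrite xM eM mulrACA.
Qed.

Definition bohr_mul (xi eta : bohr R) : bohr R := Bohr (bohr_mul_subproof xi eta).

HB.instance Definition _ := isPointed.Build (bohr R) bohr1.

(* the topology of R_B is that of pointwise convergence *)
Definition bohr_ptws (xi : bohr R) : prod_topology (fun _ : R => R[i]^o) := xi.

HB.instance Definition _ := Topological.copy (bohr R) (initial_topology bohr_ptws).

End bohr_type.

Lemma bohr_continuous (R : realType) (x : R) :
  continuous (fun xi : bohr R => xi x : R[i]^o).
Proof.
move=> xi; apply: (@continuous_comp _ _ _ (@bohr_ptws R)
  (fun f : prod_topology (fun _ : R => R[i]^o) => f x)).
  exact: initial_continuous.
exact: proj_continuous.
Qed.

Definition borel_bohr (R : realType) := g_sigma_algebraType (@open (bohr R)).

(* R_B is not metrizable, so an invariant Borel probability measure is not assumed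
   to be regular for free: regularity is part of the definition of Haar measure *)
Record is_haar (R : realType) (mu : probability (borel_bohr R) R) : Prop := IsHaar {
  haar_translation : forall (eta : bohr R) (A : set (borel_bohr R)),
    measurable A -> mu (bohr_mul eta @` A) = mu A ;
  haar_outer_regular : forall A : set (borel_bohr R), measurable A ->
    mu A = ereal_inf [set mu U | U in [set U : set (bohr R) | open U /\ A `<=` U]] ;
  haar_inner_regular : forall U : set (bohr R), open U ->
    mu U = ereal_sup [set mu K | K in [set K : set (bohr R) | compact K /\ K `<=` U]] }.

Section trigpoly.
Context {R : realType}.

(* the function x |-> e^(i lam x) *)
Definition expi (lam x : R) : R[i] := cos (lam * x) +i* sin (lam * x).

Definition trigpoly_pred : {pred R -> R[i]} := mem [set p |
  exists s : seq (R[i] * R), p = (fun x => \sum_(u <- s) u.1 * expi u.2 x)].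

Lemma trigpolyP (p : R -> R[i]) : reflect
  (exists s : seq (R[i] * R), p = (fun x => \sum_(u <- s) u.1 * expi u.2 x))
  (p \in trigpoly_pred).
Proof. by apply: (iffP idP) => [/set_mem|/mem_set]. Qed.

Lemma trigpoly_submod_closed : submod_closed trigpoly_pred.
Proof.
split.
  by apply/trigpolyP; exists [::]; apply/funext => x; rewrite big_nil.
move=> a f g /trigpolyP[s ->] /trigpolyP[t ->]; apply/trigpolyP.
exists ([seq (a * u.1, u.2) | u <- s] ++ t); apply/funext => x.
rewrite big_cat big_map/= -[LHS]/(a * (\sum_(u <- s) _) + _) mulr_sumr.
by congr (_ + _); apply: eq_bigr => u _; rewrite mulrA.
Qed.

HB.instance Definition _ := GRing.isSubmodClosed.Build _ _ trigpoly_pred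
  trigpoly_submod_closed.

Lemma expi_trigpoly (lam : R) : expi lam \in trigpoly_pred.
Proof.
apply/trigpolyP; exists [:: (1, lam)]; apply/funext => x.
by rewrite big_seq1 mul1r.
Qed.

End trigpoly.

Record trigpoly (R : realType) :=
  Trigpoly { trigpoly_val :> R -> R[i] ; _ : trigpoly_val \in @trigpoly_pred R }.

Section trigpoly_type.
Context {R : realType}.
HB.instance Definition _ := [isSub of trigpoly R for @trigpoly_val R].
HB.instance Definition _ := [Choice of trigpoly R by <:].
HB.instance Definition _ := [SubChoice_isSubLmodule of trigpoly R by <:].
Definition e_ (lam : R) : trigpoly R := Trigpoly (expi_trigpoly lam).
End trigpoly_type.

(* AP2, with the embedding j of the trigonometric polynomials, is the completion
   of their space for <p, q> = lim (1/2r) int_[-r,r] p conj(q): it is complete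
   (hilbertType), j preserves the inner product and has dense range *)
Record is_besicovitch_completion (R : realType) (AP2 : hilbertType R)
    (j : {linear trigpoly R -> AP2}) : Prop := IsBesicovitchCompletion {
  besicovitch_inner : forall p q : trigpoly R,
    (((2 * r)^-1)%:C *
      cintegral lebesgue_measure `[- r, r] (fun x => p x * conjc (q x)) : R[i]^o)
      @[r --> +oo] --> (inner (j p) (j q) : R[i]^o) ;
  besicovitch_dense : dense (range j) }.

(* F, being isometric, is the extension by continuity of its restriction to the
   finitely supported functions *)
Definition is_bohr_transform (R : realType) (AP2 : hilbertType R)
    (j : {linear trigpoly R -> AP2}) (F : hilbert_iso (l2 R) AP2) : Prop :=
  forall f : l2 R, finite_set [set lam | f lam != 0] ->
    F f = \sum_(lam \in [set lam | f lam != 0]) f lam *: j (e_ lam).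

Definition is_canonical_iso (R : realType) (mu : probability (borel_bohr R) R)
    (AP2 : hilbertType R) (j : {linear trigpoly R -> AP2})
    (iota : hilbert_iso AP2 (L2 mu)) : Prop :=
  forall lam : R, \forall xi \ae mu,
    L2_repr (iota (j (e_ lam))) xi = (xi : bohr R) lam.

Section spectral.
Context {R : realType} {mu : probability (borel_bohr R) R} {AP2 : hilbertType R}.
Variables (j : {linear trigpoly R -> AP2}) (F : hilbert_iso (l2 R) AP2)
  (iota : hilbert_iso AP2 (L2 mu)).

Definition sigma_hat (sigma : set (borel_bohr R)) (lam : R) : R[i] :=
  cintegral mu sigma (L2_repr (iota (j (e_ (- lam))))).

Definition spectral_op (sigma : set (borel_bohr R)) (msigma : measurable sigma) :
    l2 R -> l2 R :=
  iso_inv F \o iso_inv iota \o L2_mul_indic msigma \o iota \o F.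

Definition is_spectral_set (E : set (l2 R)) (sigma : set (borel_bohr R))
    (msigma : measurable sigma) : Prop :=
  E = spectral_op msigma @` [set: l2 R] /\
  @l2_val R @` E = [set f : R -> R[i] | exists phi : l2 R, forall lam,
    f lam = csum (fun alpha => sigma_hat sigma (lam - alpha) * phi alpha)].

End spectral.

(* Main.v *)
Require Import Defs.
From mathcomp Require Import all_boot all_order all_algebra.
From mathcomp Require Import finmap complex ring lra.
From mathcomp Require Import all_classical all_reals all_analysis measurable_realfun.
From mathcomp.analysis.showcase Require summability.
Set Implicit Arguments. Unset Strict Implicit. Unset Printing Implicit Defensive.
Import Order.TTheory GRing.Theory Num.Theory.
Import numFieldNormedType.Exports.
Local Open Scope classical_set_scope.
Local Open Scope ring_scope.
Local Open Scope complex_scope.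

(** The composite of the Bohr transform with the canonical isomorphism is a unitary
    map [fourier] from the sequence space onto [L2 mu]; it sends the basis vector
    at [lam] to the character [lam] (lemma [fourier_delta]) and the shift by [lam]
    to multiplication by that character ([fourier_shift]).  The theorem therefore
    describes the closed subspaces of [L2 mu] invariant under multiplication by
    all characters.

    Let [E] be closed and shift-invariant.  The orthogonal projection onto [E]
    exists ([l2_projection_exists]) and commutes with the shifts
    ([projection_shift]), because the inverse shifts also preserve [E].  Let [g] be
    the transform of the projection of the basis vector at 0.  On the Fourier side
    the projection sends a combination of characters [t] to [t * g]; by density of
    such combinations and contractivity of the projection it sends every [v] to
    [v * g] ([projection_mul]).  Applied to [g] itself, which is fixed by the
    projection, this gives [g * g = g], so [g] is the indicator of a measurable set
    ([idempotent_indic]) and the projection is the spectral operator of that set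
    ([invariant_spectral]).

    Conversely multiplications commute, so the range of a spectral operator is
    shift-invariant ([spectral_invariant]).  The description of the range by sums
    comes from computing the coefficients of a spectral operator
    ([spectral_op_csum]).  Two sets with the same range contain each other up to a
    negligible set, because each range contains the indicator of its set
    ([spectral_range_le]). *)

(** * Inner product spaces *)

Section complex_scalars.
Context {R : realType}.

Lemma gt0_complexP (e : R[i]) : 0 < e -> exists2 r : R, 0 < r & e = r%:C.
Proof.
by case: e => a b; rewrite ltcE/= => /andP[/eqP -> a0]; exists a.
Qed.

Lemma normc_ge0 (z : R[i]) : 0 <= Normc.normc z.
Proof. by case: z => a b; exact: sqrtr_ge0. Qed.

End complex_scalars.

Section inner_space.
Context {R : realType} {V : innerType R}.
Implicit Types (x y z w : V) (a : R[i]).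

(** The norm of an inner product space over [R[i]] takes values in [R[i]]; the
    estimates below are real, so they use its real part. *)
Definition rnorm x : R := complex.Re `|x|.

Lemma rnormE x : `|x| = (rnorm x)%:C.
Proof.
have := normr_ge0 x; rewrite /rnorm; case: `|x| => a b.
by rewrite lecE/= => /andP[/eqP -> _].
Qed.

Lemma rnorm_ge0 x : 0 <= rnorm x.
Proof. by have := normr_ge0 x; rewrite rnormE lecR. Qed.

Lemma rnormD x y : rnorm (x + y) <= rnorm x + rnorm y.
Proof. by have := ler_normD x y; rewrite !rnormE -rmorphD/= lecR. Qed.

Lemma rnormN x : rnorm (- x) = rnorm x.
Proof. by rewrite /rnorm normrN. Qed.

Lemma rnormB x y : rnorm (x - y) = rnorm (y - x).
Proof. by rewrite -rnormN opprB. Qed.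

Lemma rnorm0_eq0 x : rnorm x = 0 -> x = 0.
Proof. by move=> x0; apply/normr0_eq0; rewrite rnormE x0. Qed.

Lemma innerDl x y z : inner (x + y) z = inner x z + inner y z.
Proof. by rewrite linearDl. Qed.

Lemma innerDr x y z : inner z (x + y) = inner z x + inner z y.
Proof. by rewrite linearDr. Qed.

Lemma innerZl a x z : inner (a *: x) z = a * inner x z.
Proof. by rewrite linearZl_LR. Qed.

Lemma innerZr a x z : inner z (a *: x) = conjc a * inner z x.
Proof. by rewrite linearZr_LR. Qed.

Lemma innerC x y : inner x y = conjc (inner y x).
Proof. by rewrite [LHS]hermC expr0 mul1r. Qed.

Lemma inner_rnorm x : inner x x = (rnorm x ^+ 2)%:C.
Proof. by rewrite -norm_inner rnormE rmorphXn. Qed.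

Lemma sqr_rnormD x y : rnorm (x + y) ^+ 2 =
  rnorm x ^+ 2 + rnorm y ^+ 2 + 2 * complex.Re (inner x y).
Proof.
have := inner_rnorm (x + y).
rewrite innerDl !innerDr (innerC y x) !inner_rnorm.
case: (inner x y) => u v /= /(congr1 (@complex.Re R))/= <-.
by ring.
Qed.

Lemma rnormZ a x : rnorm (a *: x) = Normc.normc a * rnorm x.
Proof. by rewrite /rnorm normrZ (rnormE x) normc_def; simpc; case: a. Qed.

End inner_space.

Lemma rnorm_iso (R : realType) (V W : innerType R) (h : hilbert_iso V W) (x : V) :
  rnorm (h x) = rnorm x.
Proof.
apply/eqP; rewrite -(@eqrXn2 _ 2)// ?rnorm_ge0//; apply/eqP.
by have := iso_inner h x x; rewrite !inner_rnorm => /(congr1 (@complex.Re R)).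
Qed.

Section projection_graph.
Context {R : realType} {V : innerType R}.
Implicit Types (W : set V) (x y p q w : V).

(** The graph of the orthogonal projection onto [W]: the projection is handled as
    a relation because linearity and commutation with the shifts then follow
    from the two defining conditions, without choosing values. *)
Definition is_projection W x p := W p /\ forall w, W w -> inner (x - p) w = 0.

Lemma subspace_linear W a y z :
  GRing.submod_closed (mem W) -> W y -> W z -> W (a *: y + z).
Proof. by move=> sW /mem_set Wy /mem_set Wz; apply/set_mem; exact: sW.2. Qed.

Lemma subspace0 W : GRing.submod_closed (mem W) -> W 0.
Proof. by move=> sW; apply/set_mem; exact: sW.1. Qed.

Lemma is_projection0 W : GRing.submod_closed (mem W) -> is_projection W 0 0.
Proof.
by move=> sW; split=> [|w _]; [exact: subspace0|rewrite subr0 linear0l].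
Qed.

Lemma is_projectionP W a x y p q : GRing.submod_closed (mem W) ->
  is_projection W x p -> is_projection W y q ->
  is_projection W (a *: x + y) (a *: p + q).
Proof.
move=> sW [Wp px] [Wq qy]; split=> [|w Ww]; first exact: subspace_linear.
by rewrite opprD addrACA -scalerBr innerDl innerZl px// qy// mulr0 addr0.
Qed.

Lemma is_projectionB W x y p q : GRing.submod_closed (mem W) ->
  is_projection W x p -> is_projection W y q ->
  is_projection W (x - y) (p - q).
Proof.
move=> sW Px Py; have := is_projectionP (-1) sW Py Px.
by rewrite !scaleN1r [- y + x]addrC [- q + p]addrC.
Qed.

Lemma is_projection_mem W x : W x -> is_projection W x x.
Proof. by move=> Wx; split=> // w _; rewrite subrr linear0l. Qed.

(** Pythagoras: [x = p + (x - p)] is an orthogonal sum. *)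
Lemma rnorm_projection W x p : is_projection W x p -> rnorm p <= rnorm x.
Proof.
move=> [Wp px]; rewrite -(@ler_pXn2r _ 2)// ?nnegrE ?rnorm_ge0//.
by rewrite -[in leRHS](subrK p x) sqr_rnormD px// mulr0 addr0 lerDr sqr_ge0.
Qed.

End projection_graph.

(** * Orthogonal projection onto a closed subspace *)

Section topology.
Context {R : realType} {V : innerType R}.

Lemma closed_rnormP (W : set V) : closed W <->
  forall x, (forall e : R, 0 < e -> exists2 y, W y & rnorm (x - y) < e) -> W x.
Proof.
split=> [cW x xW|h x xW].
  apply: cW => B /nbhs_ballP[e /= e0 eB].
  have [r r0 rE] := gt0_complexP e0.
  have [y Wy xy] := xW _ r0; exists y; split=> //; apply: eB.
  by rewrite -ball_normE/= rnormE rE ltcR.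
apply: h => e e0; have /xW[y [Wy]] : nbhs x (ball x e%:C).
  by apply: nbhsx_ballx; rewrite ltcR.
by rewrite -ball_normE/= rnormE ltcR => xy; exists y.
Qed.

End topology.

Section projection.
Context {R : realType} {V : hilbertType R} (W : set V).
Hypotheses (W_subspace : GRing.submod_closed (mem W)) (W_closed : closed W).

(** The points of [W] whose squared distance to [x] is within [e ^+ 2] of the
    infimum [d] form a set of diameter at most [2 * e], by the parallelogram
    identity applied to the midpoint.  These sets generate a Cauchy filter, whose
    limit is the nearest point. *)
Lemma nearest_point (x : V) : exists2 p, W p &
  forall y, W y -> rnorm (x - p) <= rnorm (x - y).
Proof.
pose D := [set rnorm (x - y) ^+ 2 | y in W].
have D0 : has_inf D.
  split; first by exists (rnorm (x - 0) ^+ 2), 0 => //; exact: subspace0.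
  by exists 0 => _ [y _ <-]; exact: sqr_ge0.
pose d := inf D.
have dW y : W y -> d <= rnorm (x - y) ^+ 2.
  by move=> Wy; apply: ge_inf; [exact: D0.2|exists y].
have d0 : 0 <= d.
  by apply: lb_le_inf; [exact: D0.1|move=> _ [y _ <-]; exact: sqr_ge0].
pose B (e : R) := [set y | W y /\ rnorm (x - y) ^+ 2 < d + e ^+ 2].
have B0 e : 0 < e -> B e !=set0.
  move=> e0; have [|_ [y Wy <-]] := @inf_adherent _ D (e ^+ 2) _ D0.
    by rewrite exprn_gt0.
  by exists y.
pose G := filter_from [set e : R | 0 < e] B.
have GP : ProperFilter G.
  apply: filter_from_proper => //; apply: filter_from_filter.
    by exists 1 => /=.
  move=> e f /= e0 f0; exists (Num.min e f); first by rewrite lt_min e0.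
  have m0 : 0 < Num.min e f by rewrite lt_min e0.
  move=> y [Wy yd]; split; split=> //; apply: (lt_le_trans yd);
    by rewrite lerD2l ler_pXn2r// ?nnegrE ?(ltW m0) ?(ltW e0) ?(ltW f0)//
       ge_min lexx ?orbT.
have BB e y z : 0 < e -> B e y -> B e z -> rnorm (y - z) <= 2 * e.
  move=> e0 [Wy yd] [Wz zd].
  have Wm : W (2^-1 *: (y + z)).
    rewrite -[X in W X]addr0; apply: subspace_linear => //; last exact: subspace0.
    by rewrite -[y]scale1r; exact: subspace_linear.
  have md := dW _ Wm.
  (* Parallelogram identity for [x - z] and [x - y]; half their sum is the
     difference between [x] and the midpoint of [y] and [z]. *)
  have E1 : y - z = (x - z) - (x - y) by rewrite opprB [RHS]addrC subrKA.
  have E2 : x - 2^-1 *: (y + z) = 2^-1 *: ((x - z) + (x - y)).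
    have -> : (x - z) + (x - y) = 2 *: x - (y + z).
      by rewrite scaler_nat mulr2n opprD addrACA [- z - y]addrC.
    by rewrite scalerBr scalerA mulVf ?scale1r.
  rewrite -(@ler_pXn2r _ 2)// ?nnegrE ?rnorm_ge0//; last by rewrite mulr_ge0 ?ltW.
  move: md yd zd; rewrite E1 E2 rnormZ exprMn.
  move: (x - z) (x - y) => a b; rewrite !sqr_rnormD rnormN linearNr.
  have -> : Normc.normc (2^-1 : R[i]) ^+ 2 = 4^-1.
    by rewrite normc_sqr; simpc; rewrite /=; field.
  have -> : complex.Re (- inner a b) = - complex.Re (inner a b).
    by case: (inner a b).
  by lra.
have Gp : cvg G.
  apply: cauchy_cvg; apply: cauchy_exP => e e0.
  have [r r0 ->] := gt0_complexP e0.
  have e4 : 0 < r / 4 by rewrite divr_gt0.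
  have [y By] := B0 _ e4; exists y, (r / 4) => // z Bz.
  rewrite -ball_normE/= rnormE ltcR (le_lt_trans (BB _ _ _ e4 By Bz))//.
  by lra.
set p := lim G in Gp.
have near_p e : 0 < e -> exists y, B e y /\ rnorm (p - y) < e.
  move=> e0; have Bp : G (ball p e%:C).
    by apply: Gp; apply: nbhsx_ballx; rewrite ltcR.
  have Be : G (B e) by exists e.
  have [y [By]] := filter_ex (filterI Be Bp).
  by rewrite -ball_normE/= rnormE ltcR; exists y.
exists p.
  apply: (@closed_rnormP _ _ W).1 => // e e0; have [y [[Wy _] py]] := near_p e e0.
  by exists y.
move=> y Wy; apply: (@le_trans _ _ (Num.sqrt d)); last first.
  by rewrite -[leRHS]ger0_norm ?rnorm_ge0// -sqrtr_sqr ler_wsqrtr// dW.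
apply/ler_addgt0Pr => e e0.
have [z [[Wz zd] pz]] := near_p (e / 2) (divr_gt0 e0 (ltr0n _ 2)).
have -> : x - p = (x - z) + (z - p) by rewrite subrKA.
apply: (le_trans (rnormD _ _)).
have -> : Num.sqrt d + e = (Num.sqrt d + e / 2) + e / 2 by lra.
apply: lerD; last by rewrite rnormB ltW.
have s0 : 0 <= Num.sqrt d + e / 2 by rewrite addr_ge0 ?sqrtr_ge0// ltW// divr_gt0.
rewrite -(@ler_pXn2r _ 2)// ?nnegrE ?rnorm_ge0// (le_trans (ltW zd))//.
rewrite sqrrD sqr_sqrtr// lerD2r lerDl mulrn_wge0// mulr_ge0 ?sqrtr_ge0//.
by rewrite ltW// divr_gt0.
Qed.

(** If the nearest point [p] failed to satisfy [inner (x - p) w = 0], moving it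
    along [w] would bring it closer to [x]. *)
Lemma projection_exists (x : V) : exists p, is_projection W x p.
Proof.
have [p Wp pmin] := nearest_point x; exists p; split=> // w Ww.
have [->|w0] := eqVneq w 0; first by rewrite linear0r.
have n0 : 0 < rnorm w ^+ 2.
  rewrite exprn_gt0// lt_neqAle rnorm_ge0 andbT eq_sym.
  by apply: contra_neq w0 => /rnorm0_eq0.
set c := inner (x - p) w.
(* [p - t *: w] minimises the distance from [x] to the line through [p] along [w]. *)
pose t : R[i] := (- (rnorm w ^+ 2)^-1)%:C * c.
have Wpt : W (p - t *: w) by rewrite addrC -scaleNr; exact: subspace_linear.
have := pmin _ Wpt; move: Wpt => _.
have -> : x - (p - t *: w) = (x - p) + t *: w by rewrite opprD opprK addrA.
rewrite -(@ler_pXn2r _ 2)// ?nnegrE ?rnorm_ge0// (sqr_rnormD (x - p)) -addrA lerDl.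
rewrite rnormZ exprMn innerZr -/c normc_sqr {}/t.
case: {+}c => a b; simpc; rewrite /=.
move: (rnorm w ^+ 2) n0 => n n0.
set A := (X in 0 <= X -> _).
have -> : A = - ((a ^+ 2 + b ^+ 2) / n) by rewrite /A; field; rewrite gt_eqF.
rewrite oppr_ge0 pmulr_lle0 ?invr_gt0// => h.
have a0 : a = 0.
  apply/eqP; rewrite -sqrf_eq0 eq_le sqr_ge0 andbT (le_trans _ h)//.
  by rewrite lerDl sqr_ge0.
have b0 : b = 0.
  apply/eqP; rewrite -sqrf_eq0 eq_le sqr_ge0 andbT (le_trans _ h)//.
  by rewrite lerDr sqr_ge0.
by rewrite a0 b0.
Qed.

End projection.

(** * Square-integrable functions modulo a.e. equality *)

Section L2_ae.
Context d {T : measurableType d} {R : realType} (mu : {measure set T -> \bar R}).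
Implicit Types (u v w : L2 mu) (f g : sqint mu).

Lemma L2_eqP u v : u = v <-> \forall x \ae mu, L2_repr u x = L2_repr v x.
Proof. by have := L2_classE (L2_repr u) (L2_repr v); rewrite !L2_reprK. Qed.

Lemma L2_reprD u v :
  \forall x \ae mu, L2_repr (u + v) x = L2_repr u x + L2_repr v x.
Proof.
have := L2_classK (L2_repr u + L2_repr v).
by rewrite L2_classD !L2_reprK.
Qed.

Lemma L2_reprZ a u : \forall x \ae mu, L2_repr (a *: u) x = a * L2_repr u x.
Proof. exact: L2_classK. Qed.

Lemma L2_reprP a u v : \forall x \ae mu,
  L2_repr (a *: u + v) x = a * L2_repr u x + L2_repr v x.
Proof.
by apply: filterS2 (L2_reprD (a *: u) v) (L2_reprZ a u) => x -> ->.
Qed.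

Lemma L2_reprB u v :
  \forall x \ae mu, L2_repr (u - v) x = L2_repr u x - L2_repr v x.
Proof.
have := L2_reprD u (-1 *: v); rewrite scaleN1r; have := L2_reprZ (-1) v.
by rewrite scaleN1r; apply: filterS2 => x -> ->; rewrite mulN1r.
Qed.

Lemma L2_repr0 : \forall x \ae mu, L2_repr (0 : L2 mu) x = 0.
Proof.
have := L2_reprZ 0 0; rewrite scale0r; apply: filterS => x ->.
by rewrite mul0r.
Qed.

Lemma L2_inner_ae u v u' v' :
  (\forall x \ae mu, L2_repr u x * conjc (L2_repr v x) =
    L2_repr u' x * conjc (L2_repr v' x)) ->
  inner u v = inner u' v'.
Proof.
move=> h; rewrite !L2_innerE; apply: ae_eq_cintegral => //.
- by apply: cmeasurableM; [|apply: cmeasurable_conj]; exact: sqint_cmeasurable.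
- by apply: cmeasurableM; [|apply: cmeasurable_conj]; exact: sqint_cmeasurable.
Qed.

Lemma sqr_rnorm_L2 u :
  (rnorm u ^+ 2)%:E = (\int[mu]_x (Normc.normc (L2_repr u x) ^+ 2)%:E)%E.
Proof.
have [mf fi] := sqintP _ _ (sqint_valP (L2_repr u)).
have := inner_rnorm u; rewrite L2_innerE => /(congr1 (@complex.Re R))/= <-.
rewrite /Rintegral fineK.
  apply: eq_integral => x _; congr EFin.
  by rewrite normc_sqr; case: (L2_repr u x) => a b; simpc; rewrite /=; ring.
rewrite (_ : (\int[mu]_x _)%E = (\int[mu]_x (Normc.normc (L2_repr u x) ^+ 2)%:E)%E).
  by rewrite ge0_fin_numE// integral_ge0// => x _; rewrite lee_fin sqr_ge0.
apply: eq_integral => x _; congr EFin.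
by rewrite normc_sqr; case: (L2_repr u x) => a b; simpc; rewrite /=; ring.
Qed.

Section mul.
Variable (phi : T -> R[i]).
Hypotheses (mphi : cmeasurable phi) (phi1 : forall x, Normc.normc (phi x) = 1).

Lemma sqint_mul_unimodular_subproof f : (fun x => phi x * f x) \in sqint_pred mu.
Proof.
have [mf fi] := sqintP _ _ (sqint_valP f); apply/sqintP; split.
  exact: cmeasurableM.
by under eq_integral do rewrite Normc.normcM phi1 mul1r.
Qed.

Definition L2_mul_unimodular u : L2 mu :=
  L2_class (Sqint (sqint_mul_unimodular_subproof (L2_repr u))).

Lemma L2_repr_mul_unimodular u :
  \forall x \ae mu, L2_repr (L2_mul_unimodular u) x = phi x * L2_repr u x.
Proof. exact: L2_classK. Qed.

End mul.

Lemma L2_repr_mul_indic S (mS : measurable S) u :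
  \forall x \ae mu, L2_repr (L2_mul_indic mS u) x = (\1_S x)%:C * L2_repr u x.
Proof. exact: L2_classK. Qed.

Lemma inner_mul_indic S (mS : measurable S) u v :
  inner (L2_mul_indic mS u) v = inner u (L2_mul_indic mS v).
Proof.
apply: L2_inner_ae.
apply: filterS2 (L2_repr_mul_indic mS u) (L2_repr_mul_indic mS v) => x -> ->.
rewrite indicE; case: (x \in S); first by rewrite !mul1r.
by rewrite !mul0r rmorph0 mulr0.
Qed.

(** An idempotent of the pointwise product takes only the values 0 and 1. *)
Lemma idempotent_indic (u : L2 mu) :
  (\forall x \ae mu, L2_repr u x = L2_repr u x * L2_repr u x) ->
  exists (S : set T) (mS : measurable S),
    \forall x \ae mu, L2_repr u x = (\1_S x)%:C.
Proof.
move=> uu; exists [set x | L2_repr u x = 1].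
have mS : measurable [set x | L2_repr u x = 1].
  have [mr mi] := sqint_cmeasurable (L2_repr u).
  rewrite (_ : mkset _ = (fun x => complex.Re (L2_repr u x)) @^-1` [set 1] `&`
    (fun x => complex.Im (L2_repr u x)) @^-1` [set 0]).
    by apply: measurableI; rewrite -[X in measurable X]setTI;
      [apply: mr|apply: mi].
  apply/seteqP; split=> x /= => [->//|].
  by case: (L2_repr u x) => a b /= [-> ->].
exists mS; apply: filterS uu => x h.
rewrite indicE; have [u0|n0] := eqVneq (L2_repr u x) 0.
  rewrite u0 memNset//= => u1; move/eqP: (oner_neq0 R[i]); apply.
  by rewrite -u1 -u0.
have h1 : L2_repr u x = 1 by apply: (mulfI n0); rewrite mulr1 -h.
by rewrite mem_set.
Qed.

Lemma cintegral_indic S (mS : measurable S) (h : T -> R[i]) :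
  cintegral mu S h = cintegral mu [set: T] (fun x => (\1_S x)%:C * h x).
Proof.
rewrite /cintegral/Rintegral; congr (fine _ +i* fine _);
  rewrite integral_mkcond; apply: eq_integral => x _;
  rewrite patchE indicE; case: (_ \in _);
  by case: (h x) => a b; simpc; rewrite ?mul1r ?mul0r.
Qed.

End L2_ae.

(** * Characters *)

Section bohr.
Context {R : realType}.
Implicit Types (xi : bohr R) (lam kap : R).

Lemma bohrD xi lam kap : xi (lam + kap) = xi lam * xi kap.
Proof. by have /bohrP[_ ->] := valP xi. Qed.

Lemma normc_bohr xi lam : Normc.normc (xi lam) = 1.
Proof.
have /bohrP[+ _] := valP xi => /(_ lam).
by rewrite normc_def -normc_sqr sqrtr_sqr ger0_norm ?normc_ge0// => -[].
Qed.

Lemma bohr_neq0 xi lam : xi lam != 0.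
Proof.
apply/eqP => x0; have /esym/eqP := normc_bohr xi lam.
by rewrite x0 Normc.normc0 oner_eq0.
Qed.

Lemma bohr0 xi : xi 0 = 1.
Proof. by apply: (mulfI (bohr_neq0 xi 0)); rewrite mulr1 -bohrD addr0. Qed.

Lemma bohrN xi lam : xi (- lam) = conjc (xi lam).
Proof.
apply: (mulfI (bohr_neq0 xi lam)); rewrite -bohrD subrr bohr0 -sqr_normc.
by rewrite normc_def -normc_sqr normc_bohr expr1n sqrtr1 expr1n.
Qed.

Lemma measurable_continuous_bohr (f : bohr R -> R) :
  continuous f -> measurable_fun [set: borel_bohr R] (f : borel_bohr R -> R).
Proof.
move=> /continuousP cf; apply: (measurability _ (RGenOpens.measurableE R)).
move=> _ [_ [a [b ->]] <-]; apply: sub_sigma_algebra; rewrite setTI.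
by apply: cf; exact: interval_open.
Qed.

Lemma cmeasurable_bohr lam :
  cmeasurable (fun xi : borel_bohr R => (xi : bohr R) lam).
Proof.
have dist e xi : 0 < e -> \forall eta \near (xi : bohr R),
    Normc.normc (bohr_val xi lam - bohr_val eta lam) < e.
  move=> e0; have /(@cvgrPdist_lt R[i] R[i]^o _ _ (nbhs_filter (xi : bohr R))) :=
    @bohr_continuous R lam xi.
  move=> /(_ e%:C); rewrite ltcR => /(_ e0); apply: filterS => eta.
  rewrite normc_def ltcE/= eqxx/=; congr (_ < _).
  by case: (bohr_val xi lam - bohr_val eta lam).
split; apply: measurable_continuous_bohr => xi;
    apply/(@cvgrPdist_lt _ _ _ _ (nbhs_filter (xi : bohr R))) => e e0;
    apply: (@filterS _ _ (nbhs_filter (xi : bohr R)) _ _ _ (dist e xi e0)) => eta;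
    apply: le_lt_trans.
  have -> : complex.Re (bohr_val xi lam) - complex.Re (bohr_val eta lam) =
    complex.Re (bohr_val xi lam - bohr_val eta lam) by rewrite raddfB.
  exact: le_Re_normc.
have -> : complex.Im (bohr_val xi lam) - complex.Im (bohr_val eta lam) =
  complex.Im (bohr_val xi lam - bohr_val eta lam) by rewrite raddfB.
exact: le_Im_normc.
Qed.

End bohr.

(** * The canonical basis of the sequence space *)

Section l2_delta.
Context {R : realType}.
Implicit Types (f : l2 R) (lam : R).
Import summability.

Lemma csum_single {T : choiceType} (h : T -> R[i]) (lam : T) :
  (forall x, x != lam -> h x = 0) ->
  csum h = h lam.
Proof.
move=> h0; have tF : ProperFilter (@totally T) := totally_filter.
apply: (cvg_lim (@norm_hausdorff _ R[i]^o)).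
apply: cvg_near_cst; exists [fset lam]%fset => // A /= lamA.
rewrite partial_sumE (big_fsetD1 lam)/=; last by rewrite (fsubsetP lamA)// inE.
rewrite big_seq big1 ?addr0// => x; rewrite in_fsetD1 => /andP[xl _].
exact: h0.
Qed.

Lemma delta_subproof lam : (fun x : R => (x == lam)%:R : R[i]) \in l2_pred.
Proof.
apply/l2P; split.
  apply: (@sub_countable _ _ _ [set lam]); last exact: countable1.
  apply: subset_card_le => x /= h; apply/eqP; apply: contraNT h => /negbTE ->.
  by rewrite eqxx.
rewrite /sqsum (@esumID _ _ [set lam]); last by move=> x _; rewrite lee_fin sqr_ge0.
rewrite [X in (_ + X)%E]esum1; last first.
  by move=> x [_ /= /eqP/negbTE ->]; rewrite Normc.normc0 expr0n.
by rewrite adde0 setTI esum_set1 ?ltry// lee_fin sqr_ge0.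
Qed.

Definition delta lam : l2 R := L2Fun (delta_subproof lam).

Lemma inner_delta f lam : inner f (delta lam) = f lam.
Proof.
rewrite l2_innerE (@csum_single _ _ lam) /= ?eqxx ?conjc1 ?mulr1//.
by move=> x /negbTE ->; rewrite conjc0 mulr0.
Qed.

End l2_delta.

(** * Estimates in mean *)

Section L1_estimate.
Context d {T : measurableType d} {R : realType} (mu : probability T R).
Implicit Types (u v w : L2 mu).

Lemma ae0_of_integral_small (h : T -> R) (c : R) :
  measurable_fun [set: T] h -> (forall x, 0 <= h x) ->
  (forall e, 0 < e -> (\int[mu]_x (h x)%:E <= (e * c)%:E)%E) ->
  \forall x \ae mu, h x = 0.
Proof.
move=> mh h0 hc; have I0 : (0 <= \int[mu]_x (h x)%:E)%E.
  by apply: integral_ge0 => x _; rewrite lee_fin.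
have E0 : (\int[mu]_x `|(h x)%:E|)%E = 0%E.
  transitivity (\int[mu]_x (h x)%:E)%E.
    by apply: eq_integral => x _; rewrite gee0_abs// lee_fin.
  apply/eqP; rewrite eq_le I0 andbT; apply/lee_addgt0Pr => e e0; rewrite add0e.
  have c1 : 0 < `|c| + 1 by rewrite ltr_wpDl.
  have := hc (e / (`|c| + 1)); rewrite divr_gt0// => /(_ isT) /le_trans; apply.
  rewrite lee_fin mulrAC ler_pdivrMr// ler_pM2l//.
  by rewrite (le_trans (ler_norm _))// lerDl.
move/ae_eq_integral_abs: E0 => /(_ measurableT ((measurable_EFinP _ _).2 mh)).
by apply: filterS => x /(_ I) [].
Qed.

(** On a probability space, [s * t <= s ^+ 2 / e + e * t ^+ 2] bounds the mean of
    [|u| + |v| |w|] by the L2 norms, with [1] in the role of [t] for the first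
    term.  This form avoids square roots and leaves a bound linear in [e], which
    is what [ae0_of_integral_small] consumes. *)
Lemma integral_small_le u v w e : 0 < e -> rnorm u <= e -> rnorm v <= e ->
  (\int[mu]_x (Normc.normc (L2_repr u x) +
     Normc.normc (L2_repr v x) * Normc.normc (L2_repr w x))%:E <=
  (e * (3 + rnorm w ^+ 2))%:E)%E.
Proof.
move=> e0 ue ve.
have m1 z : measurable_fun [set: T] (fun x => Normc.normc (L2_repr (z : L2 mu) x)).
  by apply: measurable_normc; exact: sqint_cmeasurable.
have m2 z : measurable_fun [set: T]
    (fun x => (Normc.normc (L2_repr (z : L2 mu) x) ^+ 2)%:E).
  by apply/measurable_EFinP; apply: measurable_normc_sqr; exact: sqint_cmeasurable.
have ei0 : 0 <= e^-1 by rewrite invr_ge0 ltW.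
pose h x : \bar R := ((e^-1)%:E * ((Normc.normc (L2_repr u x) ^+ 2)%:E +
  (Normc.normc (L2_repr v x) ^+ 2)%:E) +
  e%:E * (1%:E + (Normc.normc (L2_repr w x) ^+ 2)%:E))%E.
have hE : (\int[mu]_x h x)%E = (e^-1 * (rnorm u ^+ 2 + rnorm v ^+ 2) +
    e * (1 + rnorm w ^+ 2))%:E.
  rewrite ge0_integralD//; last 4 first.
  - by move=> x _; rewrite mule_ge0 ?lee_fin// addr_ge0 ?sqr_ge0.
  - by apply: measurable_funeM; exact: emeasurable_funD.
  - by move=> x _; rewrite mule_ge0 ?lee_fin ?(ltW e0)// addr_ge0 ?sqr_ge0.
  - by apply: measurable_funeM; exact: emeasurable_funD.
  rewrite !ge0_integralZl//; last 5 first.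
  - exact: emeasurable_funD.
  - by move=> x _; rewrite lee_fin addr_ge0 ?sqr_ge0.
  - by rewrite lee_fin ltW.
  - exact: emeasurable_funD.
  - by move=> x _; rewrite lee_fin addr_ge0 ?sqr_ge0.
  rewrite !ge0_integralD//;
    try by move=> x _; rewrite lee_fin sqr_ge0.
  rewrite -!sqr_rnorm_L2 integral_cst// mul1e.
  rewrite !(EFinD, EFinM); congr (_ + _ * (_ + _))%E; exact: probability_setT.
apply: (@le_trans _ _ (\int[mu]_x h x)%E).
  apply: ge0_le_integral => //.
  - by move=> x _; rewrite lee_fin addr_ge0 ?mulr_ge0 ?normc_ge0.
  - apply/measurable_EFinP; apply: measurable_funD => //.
    exact: measurable_funM.
  - by apply: emeasurable_funD; apply: measurable_funeM; exact: emeasurable_funD.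
  - move=> x _; have -> : h x = (e^-1 * (Normc.normc (L2_repr u x) ^+ 2 +
        Normc.normc (L2_repr v x) ^+ 2) +
        e * (1 + Normc.normc (L2_repr w x) ^+ 2))%:E by [].
    rewrite lee_fin.
    set a := Normc.normc _; set b := Normc.normc _; set c := Normc.normc _.
    have am (s t : R) : 0 <= s -> 0 <= t -> s * t <= e^-1 * s ^+ 2 + e * t ^+ 2.
      move=> s0 t0; rewrite -subr_ge0.
      have -> : e^-1 * s ^+ 2 + e * t ^+ 2 - s * t =
          e^-1 * ((s - e * t) ^+ 2 + s * (e * t)).
        by field; rewrite gt_eqF.
      by rewrite mulr_ge0// addr_ge0 ?sqr_ge0// mulr_ge0// mulr_ge0// ltW.
    have := am a 1 (normc_ge0 _) ler01; have := am b c (normc_ge0 _) (normc_ge0 _).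
    by rewrite mulr1 expr1n; lra.
rewrite hE lee_fin.
have sq z : rnorm (z : L2 mu) <= e -> e^-1 * rnorm z ^+ 2 <= e.
  move=> ze; rewrite mulrC ler_pdivrMr// -expr2.
  by rewrite ler_pXn2r// ?nnegrE ?rnorm_ge0// ltW.
have := sq _ ue; have := sq _ ve; lra.
Qed.

End L1_estimate.

(** * The Fourier transform and the shifts *)

Section unitary.
Context {R : realType} {mu : probability (borel_bohr R) R} {AP2 : hilbertType R}.
Variables (j : {linear trigpoly R -> AP2}) (F : hilbert_iso (l2 R) AP2)
  (iota : hilbert_iso AP2 (L2 mu)).
Hypotheses (AP2P : is_besicovitch_completion j) (FP : is_bohr_transform j F)
  (iotaP : is_canonical_iso j iota).
Implicit Types (f g p : l2 R) (u v : L2 mu) (lam kap : R).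

Definition fourier f : L2 mu := iota (F f).
Definition fourier_inv u : l2 R := iso_inv F (iso_inv iota u).
Definition char lam : L2 mu := iota (j (e_ lam)).
Definition char_mul lam u : L2 mu :=
  L2_mul_unimodular (cmeasurable_bohr lam)
    (fun xi : borel_bohr R => normc_bohr (xi : bohr R) lam) u.

Lemma fourierK : cancel fourier fourier_inv.
Proof. by move=> f; rewrite /fourier /fourier_inv !iso_funK. Qed.

Lemma fourier_invK : cancel fourier_inv fourier.
Proof. by move=> f; rewrite /fourier /fourier_inv !iso_invK. Qed.

Lemma inner_fourier f g : inner (fourier f) (fourier g) = inner f g.
Proof. by rewrite !iso_inner. Qed.

Lemma fourierP a f g : fourier (a *: f + g) = a *: fourier f + fourier g.
Proof. by rewrite /fourier !linearP. Qed.

Lemma fourierB f g : fourier (f - g) = fourier f - fourier g.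
Proof. by rewrite /fourier !linearB. Qed.

Lemma rnorm_fourier f : rnorm (fourier f) = rnorm f.
Proof. by rewrite !rnorm_iso. Qed.

Lemma repr_char_mul lam u : \forall xi \ae mu,
  L2_repr (char_mul lam u) xi = (xi : bohr R) lam * L2_repr u xi.
Proof. exact: L2_repr_mul_unimodular. Qed.

Lemma fourier_delta lam : fourier (delta lam) = char lam.
Proof.
have D : [set l | delta lam l != 0] = [set lam].
  apply/seteqP; split=> l /=; last by move=> ->; rewrite eqxx oner_eq0.
  by move=> h; apply/eqP; apply: contraNT h => /negbTE ->; rewrite eqxx.
rewrite /fourier FP D; last exact: finite_set1.
by rewrite fsbig_set1/= eqxx scale1r.
Qed.

(** Pairing with the characters recovers the coefficients; as [fourier] is onto,
    elements of [L2 mu] may thus be compared through these pairings. *)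
Lemma fourier_inv_coef u lam : fourier_inv u lam = inner u (char lam).
Proof. by rewrite -inner_delta -inner_fourier fourier_invK fourier_delta. Qed.

Lemma inner_char_mul lam kap u :
  inner (char_mul lam u) (char kap) = inner u (char (kap - lam)).
Proof.
apply: L2_inner_ae; have := iotaP (kap - lam); have := iotaP kap.
apply: filterS3 (repr_char_mul lam u) => xi -> -> ->.
by rewrite bohrD bohrN rmorphM/= conjcK; ring.
Qed.

(** Both sides have the same pairing with every character: multiplying by the
    character [lam] moves the coefficient at [kap - lam] to [kap]. *)
Lemma fourier_shift lam f : fourier (l2_shift lam f) = char_mul lam (fourier f).
Proof.
apply: (can_inj fourier_invK); rewrite fourierK; apply/val_inj/funext => kap.
by rewrite [RHS]fourier_inv_coef inner_char_mul -fourier_inv_coef fourierK.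
Qed.

Lemma shift_inner lam f g : inner (l2_shift lam f) (l2_shift lam g) = inner f g.
Proof.
rewrite -!inner_fourier !fourier_shift; apply: L2_inner_ae.
apply: filterS2 (repr_char_mul lam (fourier f)) (repr_char_mul lam (fourier g)).
move=> xi -> ->.
rewrite rmorphM/= mulrACA -sqr_normc normc_def -normc_sqr normc_bohr.
by rewrite expr1n sqrtr1 expr1n mul1r.
Qed.

Lemma shift_delta lam : l2_shift lam (delta 0) = delta lam.
Proof. by apply/val_inj/funext => x /=; rewrite subr_eq0. Qed.

Lemma spectral_opE (S : set (borel_bohr R)) (mS : measurable S) f :
  spectral_op F iota mS f = fourier_inv (L2_mul_indic mS (fourier f)).
Proof. by []. Qed.

Lemma spectral_op_shift (S : set (borel_bohr R)) (mS : measurable S) lam f :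
  l2_shift lam (spectral_op F iota mS f) =
  spectral_op F iota mS (l2_shift lam f).
Proof.
apply: (can_inj fourierK); rewrite fourier_shift.
rewrite !spectral_opE !fourier_invK fourier_shift.
apply/L2_eqP.
apply: filterS2 (filterI (repr_char_mul lam (L2_mul_indic mS (fourier f)))
    (L2_repr_mul_indic mS (fourier f)))
  (filterI (L2_repr_mul_indic mS (char_mul lam (fourier f)))
    (repr_char_mul lam (fourier f))) => xi [-> ->] [-> ->].
by rewrite mulrCA.
Qed.

(** Multiplication by an indicator is self-adjoint, so the coefficient at [lam] is
    the inner product of [f] with the inverse transform of the indicator times
    the character [lam], whose own coefficients are the conjugates of the values
    of [sigma_hat]. *)
Lemma spectral_op_csum (S : set (borel_bohr R)) (mS : measurable S) f lam :
  spectral_op F iota mS f lam =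
  csum (fun alpha => sigma_hat j iota S (lam - alpha) * f alpha).
Proof.
rewrite spectral_opE fourier_inv_coef inner_mul_indic.
rewrite -[X in inner _ X]fourier_invK inner_fourier.
rewrite l2_innerE; congr csum; apply/funext => alpha.
rewrite mulrC; congr (_ * _); rewrite fourier_inv_coef -innerC L2_innerE /sigma_hat.
rewrite [RHS]cintegral_indic//; apply: ae_eq_cintegral.
- by apply: cmeasurableM; [|apply: cmeasurable_conj]; exact: sqint_cmeasurable.
- apply: cmeasurableM; last exact: sqint_cmeasurable.
  by split; [exact: measurable_indic|exact: measurable_cst].
apply: filterS2 (filterI (iotaP lam) (iotaP alpha))
  (filterI (L2_repr_mul_indic mS (char lam)) (iotaP (- (lam - alpha)))).
move=> xi [xl xa] [-> ->]; rewrite xl xa opprB bohrD bohrN.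
rewrite indicE; case: (xi \in S); first by rewrite !mul1r.
by rewrite !mul0r rmorph0 mulr0.
Qed.

(** [AP2] is complete, so the projection is carried out on the isometric image of
    [E] there. *)
Lemma l2_projection_exists (E : set (l2 R)) :
  GRing.submod_closed (mem E) -> closed E ->
  forall f, exists p, is_projection E f p.
Proof.
move=> sE cE f.
have sFE : GRing.submod_closed (mem (F @` E)).
  split; first by apply/mem_set; exists 0; [exact: subspace0|rewrite linear0].
  move=> a x y /set_mem[g Eg <-] /set_mem[h Eh <-]; apply/mem_set.
  by exists (a *: g + h); [exact: subspace_linear|rewrite linearP].
have cFE : closed (F @` E).
  apply/closed_rnormP => x xE; exists (iso_inv F x); last exact: iso_invK.
  apply: (closed_rnormP E).1 => // e e0; have [_ [y Ey <-] xy] := xE e e0.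
  by exists y => //; rewrite -(rnorm_iso F) linearB iso_invK.
have [_ [[p Ep <-] pP]] := projection_exists sFE cFE (F f).
exists p; split=> // w Ew; rewrite -(iso_inner F) linearB; apply: pP.
by exists w.
Qed.

Lemma trigpoly_sum (s : seq (R[i] * R)) (p : trigpoly R) :
  (p : R -> R[i]) = (fun x => \sum_(a <- s) a.1 * expi a.2 x) ->
  p = \sum_(a <- s) a.1 *: e_ a.2.
Proof.
move=> pE; apply/val_inj; rewrite /= pE {p pE}.
elim: s => [|a s IH]; first by apply/funext => x; rewrite !big_nil.
rewrite big_cons -[RHS]/(a.1 *: expi a.2 + val (\sum_(b <- s) b.1 *: e_ b.2)).
by rewrite -[val _]IH; apply/funext => x; rewrite big_cons.
Qed.

(** Transport of the density of the trigonometric polynomials in their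
    completion. *)
Lemma char_span_dense v e : 0 < e ->
  exists s : seq (R[i] * R), rnorm (v - \sum_(a <- s) a.1 *: char a.2) < e.
Proof.
move=> e0; set x := iso_inv iota v.
have ec0 : 0 < (e%:C : R[i]) by rewrite ltcR.
have xe : nbhs x (ball x e%:C) by exact: nbhsx_ballx.
have [y [/interior_subset xy [p _ py]]] :=
  besicovitch_dense AP2P (ex_intro _ x (nbhs_singleton (nbhs_interior xe)))
    (@open_interior _ _).
move: xy; rewrite -{}py -ball_normE/= rnormE ltcR => xp.
have /trigpolyP[s /trigpoly_sum pE] := valP p.
exists s; move: xp; rewrite -(rnorm_iso iota) linearB iso_invK pE.
congr (rnorm (_ - _) < _); rewrite !linear_sum.
by apply: eq_bigr => a _; rewrite !linearZ.
Qed.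

(** * Invariant subspaces *)

Definition shift_invariant (E : set (l2 R)) := forall lam, l2_shift lam @` E = E.

(** Every vector of [E] is itself a shift of a vector of [E], so shifting also
    preserves the orthogonal complement. *)
Lemma projection_shift (E : set (l2 R)) lam f p : shift_invariant E ->
  is_projection E f p -> is_projection E (l2_shift lam f) (l2_shift lam p).
Proof.
move=> inv [Ep fp]; split; first by rewrite -(inv lam); exists p.
move=> w; rewrite -[X in X w -> _](inv lam) => -[w' Ew' <-].
have -> : l2_shift lam f - l2_shift lam p = l2_shift lam (f - p) by exact: val_inj.
by rewrite shift_inner fp.
Qed.

(** Since the projection commutes with the shifts, it sends the basis vector at
    [lam] to the shift of [p0] by [lam], which on the Fourier side is the character
    [lam] times the transform of [p0]. *)
Lemma projection_char_sum (E : set (l2 R)) (p0 : l2 R) (s : seq (R[i] * R)) :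
  GRing.submod_closed (mem E) -> shift_invariant E ->
  is_projection E (delta 0) p0 ->
  exists2 q, is_projection E (\sum_(a <- s) a.1 *: delta a.2) q &
    \forall xi \ae mu, L2_repr (fourier q) xi =
      L2_repr (\sum_(a <- s) a.1 *: char a.2) xi * L2_repr (fourier p0) xi.
Proof.
move=> sE inv Pp0; elim: s => [|a s [q Pq qE]].
  exists 0; first by rewrite big_nil; exact: is_projection0.
  rewrite big_nil /fourier !linear0; apply: filterS (@L2_repr0 _ _ _ mu) => xi ->.
  by rewrite mul0r.
exists (a.1 *: l2_shift a.2 p0 + q).
  rewrite big_cons; apply: is_projectionP => //.
  by rewrite -shift_delta; exact: projection_shift.
rewrite fourierP fourier_shift big_cons.
set t := \sum_(b <- s) _ in qE *.
apply: filterS2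
  (filterI (L2_reprP a.1 (char_mul a.2 (fourier p0)) (fourier q))
    (L2_reprP a.1 (char a.2) t))
  (filterI (filterI (repr_char_mul a.2 (fourier p0)) (iotaP a.2)) qE).
by move=> xi [-> ->] [[-> ->] ->]; rewrite mulrDl mulrA.
Qed.

(** The projection is multiplication by the transform [g] of [p0].  Approximate
    the transform of [f] in norm by a combination [t] of characters, whose
    projection is [t * g].  The projection is a contraction, so its value is within
    [e] of [t * g] in L2, while [t * g] is close to the product of [g] with the
    transform of [f] only in L1, [g] not being known to be bounded.  Hence the
    comparison takes place in L1. *)
Lemma projection_mul (E : set (l2 R)) (f p p0 : l2 R) :
  GRing.submod_closed (mem E) -> shift_invariant E ->
  is_projection E (delta 0) p0 -> is_projection E f p ->
  \forall xi \ae mu,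
    L2_repr (fourier p) xi = L2_repr (fourier f) xi * L2_repr (fourier p0) xi.
Proof.
move=> sE inv Pp0 Pp.
pose h xi := L2_repr (fourier p) xi - L2_repr (fourier f) xi * L2_repr (fourier p0) xi.
have mh : cmeasurable h.
  rewrite (_ : h = fun xi => L2_repr (fourier p) xi +
    -1 * (L2_repr (fourier f) xi * L2_repr (fourier p0) xi)); last first.
    by apply/funext => xi; rewrite mulN1r.
  apply: cmeasurableD; first exact: sqint_cmeasurable.
  apply: cmeasurableM; first exact: cmeasurable_cst.
  by apply: cmeasurableM; exact: sqint_cmeasurable.
have m1 u : measurable_fun [set: borel_bohr R]
    (fun x => Normc.normc (L2_repr (u : L2 mu) x)).
  by apply: measurable_normc; exact: sqint_cmeasurable.
suff : \forall xi \ae mu, Normc.normc (h xi) = 0.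
  by apply: filterS => xi /Normc.eq0_normc/eqP; rewrite subr_eq0 => /eqP.
apply: (@ae0_of_integral_small _ _ _ _ _ (3 + rnorm (fourier p0) ^+ 2)).
- exact: measurable_normc.
- by move=> xi; exact: normc_ge0.
move=> e e0; have [s se] := char_span_dense (fourier f) e0.
have [q Pq qE] := projection_char_sum s sE inv Pp0.
set t := \sum_(a <- s) a.1 *: char a.2 in se qE.
have tE : t = fourier (\sum_(a <- s) a.1 *: delta a.2).
  rewrite /fourier !linear_sum; apply: eq_bigr => a _.
  by rewrite !linearZ -fourier_delta.
have pqe : rnorm (fourier p - fourier q) <= e.
  rewrite -fourierB rnorm_fourier.
  rewrite (le_trans (rnorm_projection (is_projectionB sE Pp Pq)))//.
  by rewrite -rnorm_fourier fourierB -tE ltW.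
have tfe : rnorm (t - fourier f) <= e by rewrite rnormB ltW.
apply: le_trans (integral_small_le (fourier p0) e0 pqe tfe).
apply: ae_ge0_le_integral => //.
- by move=> xi _; rewrite lee_fin normc_ge0.
- by apply/measurable_EFinP; exact: measurable_normc.
- by move=> xi _; rewrite lee_fin addr_ge0 ?mulr_ge0 ?normc_ge0.
- apply/measurable_EFinP; apply: measurable_funD => //.
  exact: measurable_funM.
apply: filterS3 (L2_reprB (fourier p) (fourier q)) (L2_reprB t (fourier f)) qE.
move=> xi -> -> qE _.
rewrite lee_fin -Normc.normcM mulrBl -qE /h.
rewrite -[X in Normc.normc X](subrKA (L2_repr (fourier q) xi)).
exact: le_normcD.
Qed.

(** The projection fixes [p0], so the function [g] by which it multiplies satisfies
    [g * g = g] and is an indicator. *)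
Lemma invariant_spectral (E : set (l2 R)) :
  GRing.submod_closed (mem E) -> closed E -> shift_invariant E ->
  exists (S : set (borel_bohr R)) (mS : measurable S),
    E = spectral_op F iota mS @` [set: l2 R].
Proof.
move=> sE cE inv; have [p0 Pp0] := l2_projection_exists sE cE (delta 0).
have [S [mS SE]] := idempotent_indic
  (projection_mul sE inv Pp0 (is_projection_mem Pp0.1)).
have opE f p : is_projection E f p -> spectral_op F iota mS f = p.
  move=> Pp; apply: (can_inj fourierK); rewrite spectral_opE fourier_invK; apply/L2_eqP.
  have := projection_mul sE inv Pp0 Pp.
  apply: filterS3 (L2_repr_mul_indic mS (fourier f)) SE => xi -> -> ->.
  by rewrite mulrC.
exists S, mS; apply/seteqP; split=> [f Ef|_ [f _ <-]].
  by exists f => //; apply: opE; exact: is_projection_mem.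
by have [p Pp] := l2_projection_exists sE cE f; rewrite (opE _ _ Pp); case: Pp.
Qed.

Lemma spectral_invariant (S : set (borel_bohr R)) (mS : measurable S) :
  shift_invariant (spectral_op F iota mS @` [set: l2 R]).
Proof.
move=> lam; apply/seteqP; split=> [_ [_ [f _ <-] <-]|_ [f _ <-]].
  by rewrite spectral_op_shift; exists (l2_shift lam f).
exists (spectral_op F iota mS (l2_shift (- lam) f)).
  by exists (l2_shift (- lam) f).
rewrite spectral_op_shift; congr spectral_op; apply/val_inj/funext => x /=.
by rewrite opprK subrK.
Qed.

Lemma spectral_range_csum (S : set (borel_bohr R)) (mS : measurable S) :
  @l2_val R @` (spectral_op F iota mS @` [set: l2 R]) =
  [set f : R -> R[i] | exists phi : l2 R, forall lam,
    f lam = csum (fun alpha => sigma_hat j iota S (lam - alpha) * phi alpha)].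
Proof.
apply/seteqP; split=> [_ [_ [f _ <-] <-]|f [phi fE]].
  by exists f => lam; rewrite spectral_op_csum.
exists (spectral_op F iota mS phi); first by exists phi.
by apply/funext => lam; rewrite spectral_op_csum.
Qed.

(** The range of multiplication by the indicator of [S] contains that indicator,
    the image of the constant character; elements of the other range vanish
    outside [S']. *)
Lemma spectral_range_le (S S' : set (borel_bohr R)) (mS : measurable S)
    (mS' : measurable S') :
  spectral_op F iota mS @` [set: l2 R] `<=`
    spectral_op F iota mS' @` [set: l2 R] ->
  \forall xi \ae mu, S xi -> S' xi.
Proof.
move=> SS'.
have [|f _] := SS' (spectral_op F iota mS (delta 0)); first by exists (delta 0).
move=> /(congr1 fourier); rewrite !spectral_opE !fourier_invK fourier_delta => /L2_eqP.
apply: filterS3 (filterI (L2_repr_mul_indic mS' (fourier f))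
  (L2_repr_mul_indic mS (char 0))) (iotaP 0) => xi [-> ->] ->.
move=> + Sxi; rewrite !indicE (mem_set Sxi) bohr0 mulr1.
case: (boolP (xi \in S')) => [/set_mem//|_]; rewrite mul0r => /esym/eqP.
by rewrite oner_eq0.
Qed.

Lemma spectral_set_unique (S S' : set (borel_bohr R)) (mS : measurable S)
    (mS' : measurable S') :
  spectral_op F iota mS @` [set: l2 R] = spectral_op F iota mS' @` [set: l2 R] ->
  mu (S `+` S') = 0%E.
Proof.
move=> SS'.
have le1 : \forall xi \ae mu, S xi -> S' xi by apply: spectral_range_le; rewrite SS'.
have le2 : \forall xi \ae mu, S' xi -> S xi by apply: spectral_range_le; rewrite SS'.
apply/negligibleP.
  by apply: measurableU; apply: measurableD.
apply: negligibleS (filterI le1 le2) => xi /=.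
by move=> [[Sx nS]|[Sx nS]] [h1 h2]; apply: nS; auto.
Qed.

End unitary.

Theorem corollary3p2 (R : realType)
    (mu : probability (borel_bohr R) R) (mu_haar : is_haar mu)
    (AP2 : hilbertType R) (j : {linear trigpoly R -> AP2})
    (AP2P : is_besicovitch_completion j)
    (F : hilbert_iso (l2 R) AP2) (FP : is_bohr_transform j F)
    (iota : hilbert_iso AP2 (L2 mu)) (iotaP : is_canonical_iso j iota)
    (E : set (l2 R)) (E_subspace : GRing.submod_closed (mem E))
    (E_closed : closed E) :
  (forall lam : R, l2_shift lam @` E = E) <->
  exists (sigma : set (borel_bohr R)) (msigma : measurable sigma),
    is_spectral_set j F iota E msigma /\
    forall (sigma' : set (borel_bohr R)) (msigma' : measurable sigma'),
      is_spectral_set j F iota E msigma' -> mu (sigma `+` sigma') = 0%E.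
Proof.
split=> [inv|[S [mS [[-> _] _]]]]; last exact: (spectral_invariant FP iotaP).
have [S [mS ES]] := invariant_spectral AP2P FP iotaP E_subspace E_closed inv.
exists S, mS; split=> [|S' mS' [ES' _]].
  by split=> //; rewrite ES; exact: (spectral_range_csum FP iotaP).
by apply: (spectral_set_unique FP iotaP (mS := mS) (mS' := mS')); rewrite -ES.
Qed.
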